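(* Fix $p\ge 1$ and $\lambda>0$. Let $\mathcal{C}_\lambda$ be the class of all pairs $(G^*,\mathbb{P})$ where $G^*$ is a DAG on $[p]$, $\mathbb{P}$ is a nonsingular Gaussian distribution of $(X_1,\dots,X_p)$ that is Markov to $G^*$, and $\mathbb{P}$ satisfies the $\lambda$-strong sparsest Markov representation (SMR) assumption with respect to $G^*$. Then there exists a sequence (indexed by the sample size $n$) of hypothesis tests for the conditional independence relations $X_j\perp X_k\mid X_S$ such that the SP algorithm, run on the conditional independence relations inferred by these tests from $n$ i.i.d. samples from $\mathbb{P}$, is uniformly consistent over $\mathcal{C}_\lambda$, i.e. $$\lim_{n\to\infty}\ \sup_{(G^*,\mathbb{P})\in\mathcal{C}_\lambda}\ \mathbb{P}^{n}\bigl(\text{some DAG output by the SP algorithm is not in }\mathcal{M}(G^* )\bigr)=0 .$$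
   Context: $[p]=\{1,\dots,p\}$. A DAG $G=([p],E)$ is a directed acyclic graph; $|G|$ is its number of edges. $\mathbb{P}$ is Markov to $G$ if every d-separation statement of $G$ holds as a conditional independence relation in $\mathbb{P}$. Two DAGs are Markov equivalent if they have the same d-separation statements; $\mathcal{M}(G)$ is the Markov equivalence class of $G$. $\mathbb{P}^n$ denotes the law of $n$ i.i.d. samples from $\mathbb{P}$. For a Gaussian $\mathbb{P}$, let $\Omega_\lambda(\mathbb{P})=\{(j,k,S): j\ne k\in[p],\ S\subset[p]\setminus\{j,k\},\ |\mathrm{corr}(X_j,X_k\mid X_S)|\le\lambda\}$, where $\mathrm{corr}(X_j,X_k\mid X_S)$ is the partial correlation. A DAG $G$ satisfies the Markov property with respect to a set $\Omega$ of such triples if $(j,k,S)\in\Omega$ whenever $j$ is d-separated from $k$ given $S$ in $G$. $\lambda$-strong SMR assumption of $\mathbb{P}$ with respect to $G^*$: $G^*$ satisfies the Markov property with respect to $\Omega_\lambda(\mathbb{P})$, and $|G|>|G^*|$ for every DAG $G$ on $[p]$ that satisfies the Markov property with respect to $\Omega_\lambda(\mathbb{P})$ and has $G\notin\mathcal{M}(G^* )$. Hypothesis tests: for each $n$ and each triple $(j,k,S)$ (symmetric in $j,k$), a test is a measurable function of the $n$ samples with values in $\{0,1\}$, deciding whether the relation $X_j\perp X_k\mid X_S$ is inferred to hold (value $0$) or not (value $1$). SP (sparsest permutation) algorithm on inferred relations: for each permutation $\pi$ of $[p]$ let $\hat G_\pi$ be the DAG in which $(\pi(j),\pi(k))$ is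 an edge if and only if $j<k$ and the relation $X_{\pi(j)}\perp X_{\pi(k)}\mid X_{\{\pi(1),\dots,\pi(k-1)\}\setminus\{\pi(j)\}}$ is not inferred to hold. The algorithm outputs all $\hat G_{\pi^*}$ with $|\hat G_{\pi^*}|=\min_\pi|\hat G_\pi|$. *)

(* Defs.v *)
From HB Require Import structures.
From mathcomp Require Import all_boot all_order all_algebra all_fingroup.
From mathcomp Require Import all_classical all_reals all_analysis.
Import Order.TTheory GRing.Theory Num.Theory.
Import numFieldNormedType.Exports.

Set Implicit Arguments.
Unset Strict Implicit.
Unset Printing Implicit Defensive.

Local Open Scope classical_set_scope.
Local Open Scope ring_scope.

(** * Directed graphs on [p] = 'I_p and d-separation *)

Definition digraph (p : nat) := {set 'I_p * 'I_p}.

Section Graphs.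
Variable p : nat.
Implicit Types (G H : digraph p) (a b c j k : 'I_p) (S : {set 'I_p}).

Definition edge G : rel 'I_p := [rel a b | (a, b) \in G].

Definition adjacent G : rel 'I_p := [rel a b | edge G a b || edge G b a].

Definition dag G : bool := [forall e in G, ~~ connect (edge G) e.2 e.1].

Definition collider G a b c : bool := edge G a b && edge G c b.

(* A collider is unblocked when it belongs to S or has a descendant in S
   ([connect] is reflexive); a non-collider, when it is not in S. *)
Definition unblocked G S a b c : bool :=
  if collider G a b c then [exists d in S, connect (edge G) b d]
  else b \notin S.

(* [active G S a s]: every inner node of the node sequence a :: s is
   unblocked by S. *)
Fixpoint active G S a (s : seq 'I_p) : bool :=
  match s with
  | b :: ((c :: _) as s') => unblocked G S a b c && active G S b s'
  | _ => true
  end.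

Definition dsep G j k S : Prop :=
  forall s : seq 'I_p, path (adjacent G) j s -> uniq (j :: s) ->
    last j s = k -> ~~ active G S j s.

Definition ci_triple j k S : bool := [&& j != k, j \notin S & k \notin S].

Definition ci_relation := 'I_p -> 'I_p -> {set 'I_p} -> Prop.

Definition markov_wrt G (Omega : ci_relation) : Prop :=
  forall j k S, ci_triple j k S -> dsep G j k S -> Omega j k S.

(* The Markov equivalence class M(G). *)
Definition mec G : set (digraph p) :=
  [set H | dag H /\
    forall j k S, ci_triple j k S -> (dsep G j k S <-> dsep H j k S)].

End Graphs.

(** * The law of n i.i.d. samples *)

Section IidCons.
Context d (T : measurableType d) (n : nat).

Definition iid_cons (x : T * n.-tuple T) : n.+1.-tuple T :=
  [tuple of x.1 :: x.2].

Lemma measurable_iid_cons : measurable_fun [set: T * n.-tuple T] iid_cons.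
Proof. exact: measurable_cons. Qed.

HB.instance Definition _ :=
  isMeasurableFun.Build _ _ _ _ iid_cons measurable_iid_cons.

End IidCons.

Fixpoint iid d (T : measurableType d) (R : realType) (P : probability T R)
    (n : nat) : probability (n.-tuple T) R :=
  match n with
  | 0 => \d_ [tuple]
  | m.+1 => distribution (P \x iid P m)%E (@iid_cons d T m)
  end.

Lemma iid_box d (T : measurableType d) (R : realType) (P : probability T R)
    (n : nat) (A : 'I_n -> set T) : (forall i, measurable (A i)) ->
  iid P n [set x | forall i, A i (tnth x i)] = (\prod_(i < n) P (A i))%E.
Proof.
elim: n A => [|n IH] A mA.
  by rewrite big_ord0 /= diracE mem_set//= => -[].
rewrite big_ord_recl -IH//= /distribution /pushforward.
rewrite [X in (_ \x _)%E X](_ : _ = A ord0 `*`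
    [set x : n.-tuple T | forall i, A (lift ord0 i) (tnth x i)]); last first.
  apply/seteqP; split => -[x y] /=.
    move=> h; split; first exact: (h ord0).
    by move=> i; have := h (lift ord0 i); rewrite tnthS.
  move=> [h0 h] i; case: (unliftP ord0 i) => [m|] -> //.
  by rewrite tnthS; exact: h.
rewrite product_measure1E//.
rewrite (_ : [set _ | _] = \bigcap_i ((@tnth _ T ^~ i) @^-1`
    A (lift ord0 i))); last first.
  by apply/seteqP; split => [x h i _|x h i]; exact: h.
apply: fin_bigcap_measurable => // i _.
by rewrite -[X in measurable X]setTI; apply: measurable_tnth.
Qed.

(** * Laws of random vectors (X_1, ..., X_p) *)

Section RandomVectors.
Context (R : realType) (p : nat).
Notation RV := (p.-tuple R).
Implicit Types (P : probability RV R) (j k : 'I_p) (S : {set 'I_p}).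

Definition coord j (x : RV) : R := tnth x j.

Definition affine (mu : 'cV[R]_p) (A : 'M[R]_p) (z : RV) : RV :=
  [tuple (mu + A *m \col_k tnth z k) i 0 | i < p].

(* The law of mu + A Z, where A is invertible and the coordinates of Z are
   independent standard normal variables. *)
Definition nonsingular_gaussian P : Prop :=
  exists mu : 'cV[R]_p, exists2 A : 'M[R]_p, A \in unitmx &
    forall B : set RV, measurable B ->
      P B = iid (normal_prob 0 1) p (affine mu A @^-1` B).

(* The sigma-algebra generated by X_S. *)
Definition sigma_coord S : set (set RV) :=
  g_sigma_preimage (fun i : 'I_#|S| => coord (enum_val i)).

(* f is a version of the conditional probability P(E | F). *)
Definition cond_prob_version P (F : set (set RV)) (E : set RV) (f : RV -> R) :=
  [/\ forall B, measurable B -> F (f @^-1` B),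
      P.-integrable [set: RV] (EFin \o f)
    & forall C, F C -> (\int[P]_(x in C) (f x)%:E)%E = P (E `&` C)].

(* P(X_j in A, X_k in B | X_S) = P(X_j in A | X_S) P(X_k in B | X_S) a.s. *)
Definition cond_indep P : ci_relation p := fun j k S =>
  forall A B : set R, measurable A -> measurable B ->
  exists f g : RV -> R,
    [/\ cond_prob_version P (sigma_coord S) (coord j @^-1` A) f,
        cond_prob_version P (sigma_coord S) (coord k @^-1` B) g
      & cond_prob_version P (sigma_coord S)
          (coord j @^-1` A `&` coord k @^-1` B) (f \* g)].

Definition cov P : 'M[R]_p :=
  \matrix_(j, k) fine (covariance P (coord j) (coord k)).

Definition subcov P (J K : {set 'I_p}) : 'M[R]_(#|J|, #|K|) :=
  \matrix_(a, b) cov P (enum_val a) (enum_val b).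

(* Sigma_jk - Sigma_jS Sigma_SS^-1 Sigma_Sk *)
Definition partial_cov P j k S : R :=
  cov P j k - ((\row_b cov P j (enum_val b)) *m invmx (subcov P S S) *m
               (\col_a cov P (enum_val a) k)) 0 0.

Definition partial_corr P j k S : R :=
  partial_cov P j k S /
    (Num.sqrt (partial_cov P j j S) * Num.sqrt (partial_cov P k k S)).

Definition Omega (lambda : R) P : ci_relation p := fun j k S =>
  ci_triple j k S /\ `|partial_corr P j k S| <= lambda.

Definition strong_SMR (lambda : R) P (G : digraph p) : Prop :=
  markov_wrt G (Omega lambda P) /\
  forall H : digraph p, dag H -> markov_wrt H (Omega lambda P) ->
    ~ mec G H -> (#|G| < #|H|)%N.

Definition SMR_class (lambda : R) : set (digraph p * probability RV R) :=
  [set GP | [/\ dag GP.1, nonsingular_gaussian GP.2,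
                markov_wrt GP.1 (cond_indep GP.2)
              & strong_SMR lambda GP.2 GP.1]].

(* [test j k S x = false] means that X_j _||_ X_k | X_S is inferred to hold
   from the samples x. *)
Definition ci_tests (n : nat) :=
  'I_p -> 'I_p -> {set 'I_p} -> n.-tuple RV -> bool.

Definition valid_ci_tests n (test : ci_tests n) : Prop :=
  forall j k S, ci_triple j k S ->
    test j k S = test k j S /\ measurable_fun [set: n.-tuple RV] (test j k S).

End RandomVectors.

Arguments SMR_class {R} p lambda.

(** * The sparsest permutation algorithm *)

Section SP.
Variable p : nat.
(* [dep j k S]: the relation X_j _||_ X_k | X_S is not inferred to hold. *)
Variable dep : 'I_p -> 'I_p -> {set 'I_p} -> bool.

Definition sp_cond (pi : {perm 'I_p}) (j k : 'I_p) : {set 'I_p} :=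
  ([set pi i | i : 'I_p & (i < k)%N] :\ pi j)%SET.

Definition sp_graph (pi : {perm 'I_p}) : digraph p :=
  ([set (pi jk.1, pi jk.2) | jk : 'I_p * 'I_p
     & (jk.1 < jk.2)%N && dep (pi jk.1) (pi jk.2) (sp_cond pi jk.1 jk.2)])%SET.

Definition sp_output : set (digraph p) :=
  [set G | exists2 pi : {perm 'I_p}, G = sp_graph pi &
    forall pi' : {perm 'I_p}, (#|sp_graph pi| <= #|sp_graph pi'|)%N].

End SP.

(* Some DAG output by the SP algorithm is not in M(G). *)
Definition sp_failure (R : realType) (p n : nat) (test : ci_tests R p n)
    (G : digraph p) : set (n.-tuple (p.-tuple R)) :=
  [set x | exists2 H, sp_output (fun j k S => test j k S x) H & ~ mec G H].

(* Main.v *)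
Require Import Defs.
From HB Require Import structures.
From mathcomp Require Import all_boot all_order all_algebra all_fingroup.
From mathcomp Require Import all_classical all_reals all_analysis.
From mathcomp Require Import measurable_realfun.
From mathcomp Require Import zify ring lra.
Import Order.TTheory GRing.Theory Num.Theory.
Import numFieldNormedType.Exports.
Set Implicit Arguments.
Unset Strict Implicit.
Unset Printing Implicit Defensive.

(** A test may look at the whole sample, and the tests used here decide all
relations jointly.  The sample partial correlations, thresholded at half of
lambda, give a set of accepted triples; a sparsest DAG that is Markov with
respect to the accepted triples is computed ([estimate]); the test of a triple
then answers with d-connection in that single graph ([graph_test]).

On the good event every d-separation of the true DAG Gstar is accepted and
every accepted triple has population partial correlation at most lambda.  Then
Gstar competes in the choice of the estimated graph E, so E has at most as many
edges as Gstar, and E is Markov with respect to the triples of partial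
correlation at most lambda.  Run on the d-separations of E, the sparsest
permutation algorithm returns graphs H all of whose d-separations hold in E
([sp_graph_Imap]) and that have at most as many edges as E, because a
topological order of E already gives a subgraph of E ([sp_graph_sub]).  So H
competes in the strong SMR assumption with at most as many edges as Gstar, and
must be Markov equivalent to Gstar ([sp_output_mec]).  The detour through a
graph is what makes the passage to H work: accepted triples need not obey the
intersection and contraction rules, d-separations do.  Those rules, and the
induction of Verma and Pearl that turns the relations along an ordering into
all d-separations ([soundness]), are proved for walks whose inner nodes are
colliders exactly when they are conditioned on, a reformulation of d-connection
([dconnected_not_dsep], [not_dconnected_dsep]).

For the good event, write X = mu + A Z with Z standard normal.  The sample
covariance is A W A^T, where W is the sample covariance of Z, whose law does
not depend on the distribution of X, and the population covariance is A A^T.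
A partial covariance given S is a bilinear expression in rows of A that
ignores the span of the rows of A with index in S; measured against the lengths
of the residual rows, its change from the identity to W is bounded in terms of
W alone ([residual_form_close]), however ill conditioned A is.  So the good
event contains the event that W is close to the identity, and the inequality
of Chebyshev bounds the probability of failure by K / n, with K depending only
on p and lambda ([uniform_failure_bound]).

That conditional independence forces a vanishing partial covariance
([cond_indep_orthogonal]) is not immediate, since it is expressed by versions
of conditional probabilities.  Let u and v be the residual rows of the two
variables.  Conditional independence computes the mean of exp (X_j + X_k) with
the factors exp (|u|^2 / 2) and exp (|v|^2 / 2), one for each variable; shifting
the normal law in the direction u + v (Cameron and Martin) computes it with the
factor exp (|u + v|^2 / 2).  Comparison gives u . v = 0. *)

(** * Walks and d-separation *)
Section Chains.
Import mathcomp.boot.fintype mathcomp.boot.finset.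
Variable T : eqType.
Implicit Types (U V : T -> T -> T -> bool) (w s : seq T).

Fixpoint chain U w : bool :=
  match w with
  | a :: ((b :: (c :: _)) as w') => U a b c && chain U w'
  | _ => true
  end.

Lemma chain_cons3 U x y z w :
  chain U [:: x, y, z & w] = U x y z && chain U [:: y, z & w].
Proof. by []. Qed.

Lemma chain_cat U s1 a b s2 :
  chain U (s1 ++ [:: a, b & s2]) =
  chain U (s1 ++ [:: a; b]) && chain U [:: a, b & s2].
Proof.
elim: s1 => [//|x [|y s1] IH]; first by rewrite /= andbT.
by case: s1 IH => [|z s1] IH; rewrite !cat_cons chain_cons3 IH andbA.
Qed.

Lemma chain_catl U s1 s2 : chain U (s1 ++ s2) -> chain U s1.
Proof.
elim: s1 => [//|x [|y [|z s1]] IH] //= /andP[-> h] /=; exact: IH.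
Qed.

Lemma chain_catr U s1 s2 : chain U (s1 ++ s2) -> chain U s2.
Proof.
elim: s1 => [//|x s1 IH] /= h; apply: IH.
by case: (s1 ++ s2) h => [|y [|z w]] //= /andP[].
Qed.

Lemma chain_rev U w : chain U (rev w) = chain (fun a b c => U c b a) w.
Proof.
elim: w => [//|a [|b [|c w]] IH] //.
have -> : rev [:: a, b, c & w] = rev w ++ [:: c, b & [:: a]].
  by rewrite !rev_cons -!cats1 -!catA.
rewrite chain_cat [in RHS]chain_cons3 -IH [RHS]andbC; congr (_ && _).
  by rewrite !rev_cons -!cats1 -!catA.
by rewrite /= andbT.
Qed.

Lemma eq_chain U V w : (forall a b c, U a b c = V a b c) -> chain U w = chain V w.
Proof. by move=> e; elim: w => [//|a [|b [|c w]] IH] //; rewrite !chain_cons3 e IH. Qed.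

Lemma sub_chain U V w :
  (forall a b c, U a b c -> V a b c) -> chain U w -> chain V w.
Proof.
move=> e; elim: w => [//|a [|b [|c w]] IH] //; rewrite !chain_cons3 => /andP[/e-> h]; exact: IH h.
Qed.

(** A walk that is open for U but not for U and V can be cut at the first
triple that violates V; this drives every argument that cuts a walk where it
first meets a set. *)
Lemma chain_first U V w : chain U w ->
  chain (fun a b c => U a b c && V a b c) w \/
  exists s1 a b c s2, [/\ w = s1 ++ [:: a, b, c & s2],
    chain (fun a b c => U a b c && V a b c) (s1 ++ [:: a; b]),
    U a b c & ~~ V a b c].
Proof.
elim: w => [|x [|y [|z w]] IH]; [by left|by left|by left|].
rewrite [chain U _]/= => /andP[Ux h].
have [Vx|nV] := boolP (V x y z); last first.
  by right; exists [::], x, y, z, w.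
have [{}IH|[s1 [a [b [c [s2 [e h1 Ua Va]]]]]]] := IH h.
  by left; rewrite /= Ux Vx.
right; exists (x :: s1), a, b, c, s2; split => //; first by rewrite e.
move: e h1; case: s1 => [|y1 [|z1 s1]] [<- <- _] h1.
- by rewrite /= Ux Vx.
- by rewrite !cat_cons chain_cons3 Ux Vx.
- by rewrite !cat_cons chain_cons3 Ux Vx.
Qed.

Lemma nuniq_split w : ~~ uniq w ->
  exists s1 b s2 s3, w = s1 ++ b :: s2 ++ b :: s3.
Proof.
elim: w => [//|a w IH] /=; rewrite negb_and negbK => /orP[|/IH].
  by case/splitPr => p1 p2; exists [::], a, p1, p2.
by move=> [s1 [b [s2 [s3 ->]]]]; exists (a :: s1), b, s2, s3.
Qed.

End Chains.

Local Notation adj := Defs.adjacent.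

#[local] Arguments Defs.edge : simpl never.
#[local] Arguments Defs.adjacent : simpl never.

Section Connection.
Import mathcomp.boot.fintype mathcomp.boot.finset.
Variables (p : nat) (G : digraph p).
Implicit Types (a b c x y : 'I_p) (S : {set 'I_p}) (s w : seq 'I_p).

(** d-separation lets a collider through when some descendant is in S.  For walks
that may repeat nodes the descendant is superfluous: the walk can go down to it
and come back.  This leaves a symmetric condition on S, which changes in a
transparent way when S grows or shrinks. *)
Definition strictly_open S a b c := collider G a b c == (b \in S).

Definition linked U x y : Prop :=
  exists s, [/\ path (adj G) x s, last x s = y & chain U (x :: s)].

Definition dconnected S x y := linked (strictly_open S) x y.

Lemma adjE a b : adj G a b = edge G a b || edge G b a.
Proof. by []. Qed.

Lemma adjacentC a b : adj G a b = adj G b a.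
Proof. by rewrite /Defs.adjacent/= orbC. Qed.

Lemma colliderC a b c : collider G a b c = collider G c b a.
Proof. by rewrite /collider andbC. Qed.

Lemma activeE S a s : active G S a s = chain (unblocked G S) (a :: s).
Proof. by elim: s a => [//|b [//|c s] IH] a; rewrite chain_cons3 -IH. Qed.

Lemma dconnected_sym S x y : dconnected S x y -> dconnected S y x.
Proof.
move=> [s [ps <- cs]]; exists (rev (belast x s)); split.
- by rewrite rev_path; under eq_path => a b do rewrite adjacentC.
- by case: (s) => [//|b s']; rewrite /= rev_cons last_rcons.
- rewrite -[_ :: rev _]rev_rcons -lastI chain_rev.
  by under eq_chain => a b c do rewrite /strictly_open colliderC.
Qed.

Hypothesis dagG : dag G.

Lemma dag_edge a b : edge G a b -> ~~ connect (edge G) b a.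
Proof. by move=> ab; have /forall_inP/(_ (a, b) ab) := dagG. Qed.

Lemma dag_asym a b : edge G a b -> edge G b a = false.
Proof. by move=> ab; apply: contraNF (dag_edge ab) => ba; apply: connect1. Qed.

(** An unblocked walk that starts downwards either keeps descending, or turns at
a collider, and then that collider has a descendant in S. *)
Lemma going_down S b n r : edge G b n -> path (adj G) n r ->
  chain (unblocked G S) [:: b, n & r] ->
  (exists2 d, d \in S & connect (edge G) n d) \/ connect (edge G) n (last n r).
Proof.
elim: r b n => [|m r IH] b n bn; first by right.
rewrite /= => /andP[nm pr] /andP[u ch].
have [nC|C] := boolP (edge G n m); last first.
  move: nm; rewrite adjE (negbTE C) /= => nm.
  left; move: u; rewrite /unblocked /collider bn nm => /exists_inP[d dS nd].
  by exists d.
have [[d dS md]|ml] := IH n m nC pr ch.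
  by left; exists d => //; apply: connect_trans md; apply: connect1.
by right; apply: connect_trans ml; apply: connect1.
Qed.

(** Removing a loop at b keeps the walk unblocked.  The one delicate case is that
b becomes a collider: if the loop left b downwards, then either it met a
collider, whose descendant in S is a descendant of b, or it came back to b along
a directed cycle. *)
Lemma shortcut S s1 b s2 s3 :
  let w := s1 ++ b :: s2 ++ b :: s3 in
  sorted (adj G) w -> chain (unblocked G S) w ->
  chain (unblocked G S) (s1 ++ b :: s3).
Proof.
move=> w sw cw.
case/lastP: s1 @w sw cw => [|s1 a] w sw cw; first exact: (@chain_catr _ _ (b :: s2)).
case: s3 @w sw cw => [|c s3] w sw cw.
  by apply: (@chain_catl _ _ _ (s2 ++ [:: b])); rewrite -catA.
have [n1 [r [e1 lr]]] : exists n1 r, s2 ++ [:: b] = n1 :: r /\ last n1 r = b.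
  case: (s2) => [|n1 r]; first by exists b, [::].
  by exists n1, (r ++ [:: b]); rewrite last_cat.
have [r' [n2 e2]] : exists r' n2, b :: s2 = rcons r' n2.
  by rewrite lastI; exists (belast b s2), (last b s2).
have wE : w = s1 ++ [:: a, b, n1 & r] ++ c :: s3.
  by rewrite /w -cats1 -catA /= -[n1 :: _]/((n1 :: r) ++ _) -e1 -catA.
have wE2 : w = (rcons s1 a ++ r') ++ [:: n2, b, c & s3].
  by rewrite -catA; congr (_ ++ _); rewrite -[RHS]cat_rcons -e2.
have U1 : chain (unblocked G S) [:: a, b, n1 & r].
  by move: cw; rewrite wE => /chain_catr/chain_catl.
have U2 : unblocked G S n2 b c.
  by move: cw; rewrite wE2 => /chain_catr; rewrite chain_cons3 => /andP[].
have P1 : path (adj G) a [:: b, n1 & r].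
  by move: sw; rewrite wE => /cat_sorted2[_] /cat_sorted2[].
rewrite -cats1 -catA /= chain_cat; apply/andP; split.
  apply: (@chain_catl _ _ _ (n1 :: r ++ c :: s3)).
  by rewrite -catA; move: cw; rewrite wE.
rewrite chain_cons3; apply/andP; split; last first.
  by move: cw; rewrite wE2 => /chain_catr; rewrite chain_cons3 => /andP[].
move: U1; rewrite chain_cons3 => /andP[u1 cr]; move: P1 => /= /and3P[ab bn1 pr].
rewrite /unblocked; case: ifPn => [/andP[ab' cb]|nC].
  (* b is now a collider and needs a descendant in S *)
  have : (exists2 d, d \in S & connect (edge G) b d); last first.
    by move=> [d dS bd]; apply/exists_inP; exists d.
  move: u1; rewrite /unblocked; case: ifPn => [_ /exists_inP//|].
  rewrite /collider ab' /= => nn1 _.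
  have bn : edge G b n1 by move: bn1; rewrite adjE (negbTE nn1) orbF.
  have [[d dS nd]|] := going_down bn pr cr.
    by exists d => //; apply: connect_trans nd; apply: connect1.
  by rewrite lr => h; have := dag_edge bn; rewrite h.
(* if b is in S then it was a collider on both sides of the loop *)
apply/negP => bS; move: nC u1 U2; rewrite /unblocked /collider bS.
case: (edge G a b) => //=; case: (edge G c b) => //=.
by rewrite andbF.
Qed.

Lemma dconnected_not_dsep S x y : dconnected S x y -> ~ dsep G x y S.
Proof.
move=> [s [ps ls cs]].
have {}cs : chain (unblocked G S) (x :: s).
  apply: sub_chain cs => a b c /eqP e; rewrite /unblocked e.
  by case: ifPn => // bS; apply/exists_inP; exists b.
have [n] := ubnP (size s); elim: n s ps ls cs => // n IH s ps ls cs sn.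
have [us|/nuniq_split[s1 [b [s2 [s3 e]]]]] := boolP (uniq (x :: s)).
  by move=> /(_ s ps us ls); rewrite activeE cs.
have := @shortcut S s1 b s2 s3; rewrite -e /= => /(_ ps cs) cs'.
move: ps ls cs sn cs'; case: s1 e => [[ex ->]|a s1 [ex ->]]; rewrite -?ex.
  rewrite cat_path last_cat /= size_cat /= => /and3P[_ _ ps] ls cs sn cs'.
  by apply: (IH s3) => //; lia.
rewrite !cat_path !last_cat /= !cat_path !last_cat /= !size_cat /= !size_cat /=.
move=> /and5P[p1 p2 _ _ p3] ls cs sn cs'; apply: (IH (s1 ++ b :: s3)) => //.
- by rewrite cat_path /= p1 p2.
- by rewrite last_cat.
- by rewrite size_cat /=; lia.
Qed.

(** The walk that replaces the descendant clause: down to the first node of S,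
which is a collider there, and back the same way. *)
Lemma detour S b d : b \notin S -> d \in S -> connect (edge G) b d ->
  exists e f r, [/\ edge G b e, edge G b f, last e r = f &
    path (adj G) b (rcons (e :: r) b) /\
    chain (strictly_open S) (b :: rcons (e :: r) b)].
Proof.
move=> bS dS /connectP[q pq lq].
elim: q b bS pq lq => [|e q IH] b bS; first by move=> _ /= e; rewrite e (negbTE bS) in dS.
move=> /= /andP[be pq] lq; have eb := dag_asym be.
have [eS|eS] := boolP (e \in S).
  exists e, e, [::]; split => //; split; first by rewrite /= !adjE be orbT.
  by rewrite /= /strictly_open /collider be eS eqxx.
have [e' [f' [r [ee' ef' lr [pr cr]]]]] := IH e eS pq lq.
exists e, e, (rcons (e' :: r) e); split; rewrite ?last_rcons//; split.
  by move: pr; rewrite /= !rcons_path /= !last_rcons !adjE be eb => /andP[-> ->].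
have [r0 er] : exists r0, e' :: r = rcons r0 f'.
  by rewrite lastI lr; exists (belast e' r).
move: cr; rewrite er -!cats1 -!catA => cr.
change (chain (strictly_open S) ([:: b] ++ [:: e & r0 ++ [:: f', e & [:: b]]])).
have -> : [:: e & r0 ++ [:: f', e & [:: b]]] = [:: e, e' & r ++ [:: e; b]].
  by rewrite -[e' :: _]/((e' :: r) ++ _) er -cats1 -catA.
rewrite cat1s chain_cons3; apply/andP; split.
  by rewrite /strictly_open /collider be (dag_asym ee') (negbTE eS).
rewrite -[e' :: _]/((e' :: r) ++ _) er -cats1 -catA.
rewrite -cat_cons chain_cat; apply/andP; split; first exact: cr.
by rewrite /= /strictly_open /collider (dag_asym ef') (negbTE eS).
Qed.

Lemma not_dconnected_dsep S x y : ~ dconnected S x y -> dsep G x y S.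
Proof.
move=> nc s ps us ls; apply/negP; rewrite activeE => cs; apply: nc.
case: s ps {us} ls cs => [|b s] ps ls cs; first by exists [::].
have [s' [ps' ls' cs']] : exists s', [/\ path (adj G) x (b :: s'),
    last b s' = last b s & chain (strictly_open S) [:: x, b & s']].
  elim: s x b ps cs {ls} => [|c s IH] x' b' ps cs; first by exists [::].
  move: ps cs; rewrite chain_cons3 => /andP[xb ps] /andP[u cs].
  have [s' [ps' ls' cs']] := IH b' c ps cs.
  have [st|nst] := boolP (strictly_open S x' b' c).
    exists (c :: s'); split => //; first by apply/andP.
    by rewrite chain_cons3 st.
  (* only a collider outside S can be unblocked without being strictly open *)
  have : (collider G x' b' c) && (b' \notin S).
    move: u nst; rewrite /unblocked /strictly_open.
    by case: (collider G x' b' c); case: (b' \in S).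
  move=> /andP[col bS]; move: u; rewrite /unblocked col => /exists_inP[d dS bd].
  have [e [f [r [be bf lr [pr cr]]]]] := detour bS dS bd.
  have [r0 er] : exists r0, e :: r = rcons r0 f.
    by rewrite lastI lr; exists (belast e r).
  exists (rcons (e :: r) b' ++ c :: s'); split.
  - have pp : path (adj G) b' (rcons (e :: r) b' ++ c :: s').
      by rewrite cat_path pr last_rcons.
    by apply/andP.
  - by rewrite last_cat.
  rewrite [rcons (e :: r) b' ++ _]/= chain_cons3; apply/andP; split.
    by rewrite /strictly_open /collider (dag_asym be) andbF (negbTE bS).
  rewrite cat_rcons -[_ :: _ :: r ++ _]/(b' :: (e :: r) ++ _) er cat_rcons.
  rewrite -cat_cons chain_cat chain_cons3 cs' andbT; apply/andP; split.
    by move: cr; rewrite er -!cats1 -catA.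
  by rewrite /strictly_open /collider (dag_asym bf) (negbTE bS).
by exists (b :: s'); rewrite -ls /= ls'.
Qed.

End Connection.

(** * Separation rules *)

Section Semigraphoid.
Import mathcomp.boot.fintype mathcomp.boot.finset.
Variables (p : nat) (G : digraph p).
Implicit Types (a b c t w x y : 'I_p) (D P W X Y Z : {set 'I_p}).

Definition sep Z X Y := forall x y, x \in X -> y \in Y -> ~ dconnected G Z x y.

Lemma sepC Z X Y : sep Z X Y -> sep Z Y X.
Proof. by move=> h x y xY yX /dconnected_sym; apply: h. Qed.

Lemma sub_linked (U V : 'I_p -> 'I_p -> 'I_p -> bool) x y :
  (forall a b c, U a b c -> V a b c) -> linked G U x y -> linked G V x y.
Proof. by move=> UV [s [ps ls cs]]; exists s; split => //; exact: sub_chain cs. Qed.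

(** Cutting at the first node of W makes W invisible to the opening condition. *)
Lemma linked_first (U : 'I_p -> 'I_p -> 'I_p -> bool) W x y : linked G U x y ->
  let U' := fun a b c => U a b c && (b \notin W) in
  linked G U' x y \/ exists2 w, w \in W & linked G U' x w.
Proof.
move=> [s [ps ls cs]] U'.
have [cs'|] := chain_first (fun a b c => b \notin W) cs; first by left; exists s.
move=> [s1 [a [b [c [s2 [e cs1 _]]]]]]; rewrite negbK => bW.
right; exists b => //; case: s1 e cs1 => [|x1 s1] [<- e] cs1.
  by exists [:: b]; split => //; move: ps; rewrite e /= => /andP[->].
exists (s1 ++ [:: a; b]); split => //; last by rewrite last_cat.
by move: ps; rewrite e !cat_path /= => /and4P[-> -> -> _].
Qed.

Lemma sep_weak_union Z X Y W : sep Z X (Y :|: W) -> sep (Z :|: W) X Y.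
Proof.
move=> h x y xX yY /(linked_first W) [|[w wW]] l.
  apply: (h x y) => //; first by rewrite inE yY.
  apply: sub_linked l => a b c /andP[]; rewrite /strictly_open inE => + /negbTE bW.
  by rewrite bW orbF.
apply: (h x w) => //; first by rewrite inE wW orbT.
apply: sub_linked l => a b c /andP[]; rewrite /strictly_open inE => + /negbTE bW.
by rewrite bW orbF.
Qed.

Lemma sep_contraction Z X P Y :
  sep Z Y P -> sep (Z :|: P) Y X -> sep Z Y X.
Proof.
move=> hP hX y x yY xX /(linked_first P) [|[q qP]] l.
  apply: (hX y x) => //; apply: sub_linked l => a b c /andP[].
  by rewrite /strictly_open inE => + /negbTE bP; rewrite bP orbF.
by apply: (hP y q) => //; apply: sub_linked l => a b c /andP[].
Qed.

(** An iterated intersection rule: t is separated from each node of D outside P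
given all the rest of D.  On a walk from t to D outside P, stop at the first
such node w; the inner nodes are then in P or outside D, so conditioning on P or
on D without w makes no difference. *)
Lemma sep_local t D P : P \subset D ->
  (forall w, w \in D :\: P -> ~ dconnected G (D :\ w) t w) ->
  sep P [set t] (D :\: P).
Proof.
move=> PD h _ w /set1P-> wD l.
have {l} : exists2 w, w \in D :\: P & linked G (fun a b c =>
    strictly_open G P a b c && (b \notin D :\: P)) t w.
  by case: (linked_first (D :\: P) l) => // l'; exists w.
move=> [{wD}w wD l]; apply: (h w wD); apply: sub_linked l => a b c /andP[].
rewrite /strictly_open !inE => /eqP-> bDP.
have [bP|bP] := boolP (b \in P).
  rewrite (subsetP PD)//=; have [e|//] := eqVneq b w.
  by move: wD; rewrite inE -e bP.
by move: bDP; rewrite bP /= => /negbTE->; rewrite andbF.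
Qed.

End Semigraphoid.

(** * Graphs compatible with an ordering of the nodes *)

Section Order.
Import mathcomp.boot.fintype mathcomp.boot.finset.
Variables (p : nat) (G : digraph p) (pos : 'I_p -> nat).
Hypothesis pos_inj : injective pos.
Hypothesis pos_edge : forall a b, edge G a b -> (pos a < pos b)%N.
Implicit Types (a b c x y t : 'I_p) (X Y Z W P : {set 'I_p}).

Definition below m : {set 'I_p} := [set c | (pos c < m)%N].

Lemma pos_dag : dag G.
Proof.
apply/forall_inP => -[a b] /= /pos_edge ab; apply/negP => /connectP[s ps e].
suff : (pos b <= pos a)%N by rewrite leqNgt ab.
rewrite e; elim: s b ps {ab e} => [//|c s IH] b /= /andP[/pos_edge/ltnW bc /IH].
exact: leq_trans.
Qed.

Lemma adj_edge a b : (pos a < pos b)%N -> adj G a b -> edge G a b.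
Proof.
by move=> ab; rewrite adjE => /orP[//|/pos_edge]; rewrite ltnNge ltnW.
Qed.

(** Above the conditioning set there is no open collider, so a walk that has gone
up past the level of that set must keep following edges upwards. *)
Lemma climb Z m a b s : Z \subset below m -> edge G a b -> (m <= pos b)%N ->
  path (adj G) b s -> chain (strictly_open G Z) [:: a, b & s] -> (m <= pos (last b s))%N.
Proof.
move=> Zm; elim: s a b => [//|c s IH] a b ab mb /andP[bc ps].
rewrite chain_cons3 => /andP[st cs].
have bZ : b \in Z = false.
  by apply/negP => /(subsetP Zm); rewrite inE ltnNge mb.
have eb : edge G b c.
  move: st bc; rewrite /strictly_open /collider bZ ab /= adjE.
  by case: (edge G c b); rewrite ?orbF.
by apply: (IH b c) => //; apply: leq_trans mb (ltnW _); exact: pos_edge.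
Qed.

Lemma stay_below Z m x s : Z \subset below m -> (pos x < m)%N ->
  (pos (last x s) < m)%N -> path (adj G) x s -> chain (strictly_open G Z) (x :: s) ->
  {in s, forall c, c \in below m}.
Proof.
move=> Zm; elim: s x => [//|b s IH] x xm lm /andP[xb ps] cs.
have bm : (pos b < m)%N.
  rewrite ltnNge; apply/negP => mb.
  have e : edge G x b by apply: adj_edge xb; apply: leq_trans xm mb.
  by have := climb Zm e mb ps cs; rewrite leqNgt lm.
move=> c; rewrite inE => /orP[/eqP->|]; first by rewrite inE.
by apply: (IH b) => //; exact: (@chain_catr _ _ [:: x]).
Qed.

(** A node is separated from a non-parent that precedes it, given all other
predecessors: a connecting walk stays among the predecessors, so it enters b
through a parent c of b, which is a non-collider; being conditioned on, c blocks
the walk. *)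
Lemma ordered_markov a b : (pos a < pos b)%N -> ~~ edge G a b ->
  ~ dconnected G (below (pos b) :\ a) a b.
Proof.
move=> ab nab /dconnected_sym[[|c s] [ps ls cs]].
  by move: ab; rewrite -ls ltnn.
have Zm : below (pos b) :\ a \subset below (pos b).+1.
  by apply/subsetP => d; rewrite !inE => /andP[_ /ltnW].
have cb : edge G c b.
  have cm : c \in below (pos b).+1.
    have lm : (pos (last b (c :: s)) < (pos b).+1)%N by rewrite ls ltnS ltnW.
    by apply: (stay_below Zm (ltnSn _) lm ps cs); rewrite inE eqxx.
  move: ps => /andP[bc _]; apply: adj_edge; last by rewrite adjacentC.
  rewrite inE ltnS leq_eqVlt in cm; case/orP: cm => // /eqP/pos_inj e.
  move: bc; rewrite e adjE orbb => /pos_edge; by rewrite ltnn.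
case: s ps ls cs => [|d s] ps ls cs; first by move: nab; rewrite -ls /= cb.
have ca : c != a by apply: contra nab => /eqP <-.
move: cs; rewrite chain_cons3 /strictly_open /collider !inE ca pos_edge//=.
have -> : edge G b c = false by apply/negP => /pos_edge; rewrite ltnNge ltnW ?pos_edge.
by [].
Qed.

End Order.

(** * Ordered pairwise independence and the sparsest permutation *)
Section Soundness.
Import mathcomp.boot.fintype mathcomp.boot.finset.
Variables (p : nat) (G H : digraph p) (pos : 'I_p -> nat).
Hypothesis pos_inj : injective pos.
Hypothesis pos_edge : forall a b, edge H a b -> (pos a < pos b)%N.
Hypothesis pairwise : forall a b, (pos a < pos b)%N -> ~~ edge H a b ->
  ~ dconnected G (below pos (pos b) :\ a) a b.
Implicit Types (a b c t x y : 'I_p) (P X Y Z W : {set 'I_p}).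

Local Notation parents t := [set q | edge H q t]%SET.

Lemma parents_below t : parents t \subset below pos (pos t).
Proof. by apply/subsetP => q; rewrite !inE; exact: pos_edge. Qed.

Lemma local_markov t :
  sep G (parents t) [set t] (below pos (pos t) :\: parents t).
Proof.
apply: sep_local (parents_below t) _ => w; rewrite !inE => /andP[nw wt].
by move=> /dconnected_sym; exact: pairwise.
Qed.

Lemma connect_parent Z q t y : edge H q t -> q \notin Z ->
  dconnected H Z q y -> dconnected H Z t y.
Proof.
move=> qt qZ [s [ps ls cs]]; exists (q :: s); split => //.
  by apply/andP; split => //; rewrite adjE qt orbT.
case: s cs {ps ls} => [|c s] cs //; rewrite chain_cons3 cs andbT.
have -> : strictly_open H Z t q c = true; last by [].
rewrite /strictly_open /collider (negbTE qZ).
suff -> : edge H t q = false by [].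
by apply/negP => /pos_edge; rewrite ltnNge ltnW// pos_edge.
Qed.

(** For a node t above everything else, two walks ending in t can be glued into a
walk on which t is a collider, which is open once t is conditioned on. *)
Lemma connect_join Z t x y : Z \subset below pos (pos t) ->
  (pos x < pos t)%N -> (pos y < pos t)%N ->
  dconnected H Z x t -> dconnected H Z y t -> dconnected H (Z :|: [set t]) x y.
Proof.
move=> Zt.
have into : forall x, (pos x < pos t)%N -> dconnected H Z x t ->
    exists r c, [/\ path (adj H) x (rcons r t), last x r = c, edge H c t
      & chain (strictly_open H (Z :|: [set t])) (x :: rcons r t)].
  move=> {}x xt l.
  have {l} : linked H (fun a b c => strictly_open H Z a b c && (b \notin [set t])) x t.
    by case: (linked_first [set t] l) => // -[w /set1P->].
  move=> [s [ps ls cs]].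
  case/lastP: s ps ls cs => [|r c] ps; first by move=> /= e; rewrite e ltnn in xt.
  rewrite last_rcons => e; rewrite {}e in ps * => cs.
  exists r, (last x r); split => //; last first.
    apply: sub_chain cs => a b d /andP[]; rewrite /strictly_open !inE => + /negbTE bt.
    by rewrite bt orbF.
  move: (ps); rewrite rcons_path => /andP[pr ct].
  (* the walk stays at or below the level of t, so it enters t by an edge to t *)
  have lt_t : (pos (last x r) < (pos t).+1)%N.
    case/lastP: r ps {pr ct} cs => [|r c'] ps cs; first by rewrite /= ltnW.
    have Zt' : Z \subset below pos (pos t).+1.
      by apply: subset_trans Zt _; apply/subsetP => d; rewrite !inE => /ltnW.
    have cs' : chain (strictly_open H Z) (x :: rcons (rcons r c') t).
      by apply: sub_chain cs => a b d /andP[].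
    have lt : (pos (last x (rcons (rcons r c') t)) < (pos t).+1)%N by rewrite last_rcons.
    have := stay_below pos_edge Zt' (ltnW xt) lt ps cs'.
    have cr : c' \in rcons (rcons r c') t by rewrite !(mem_rcons, inE) eqxx orbT.
    by move=> /(_ _ cr); rewrite inE last_rcons.
  apply: (adj_edge pos_edge) (ct).
  move: lt_t; rewrite ltnS leq_eqVlt => /orP[/eqP/pos_inj e|//].
  by move: ct; rewrite e adjE orbb => /pos_edge; rewrite ltnn.
move=> xt yt /(into _ xt)[r [c [pr lr ct cr]]] /(into _ yt)[r' [c' [pr' lr' ct' cr']]].
have [w [ew pw]] : exists w, rev (y :: r') = c' :: w /\
    (path (adj H) t (c' :: w) /\ last c' w = y).
  exists (rev (belast y r')); rewrite -lr' lastI rev_rcons; split => //; split.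
    have := rev_path (adj H) y (rcons r' t); rewrite last_rcons belast_rcons lastI rev_rcons.
    move=> ->; rewrite -(eq_path (e := adj H)) // => a b; exact: adjacentC.
  by case: (r') => [//|z s]; rewrite /= rev_cons last_rcons.
have cw : chain (strictly_open H (Z :|: [set t])) [:: t, c' & w].
  rewrite -ew -rev_rcons chain_rev rcons_cons -(eq_chain (U := strictly_open H (Z :|: [set t]))) //.
  by move=> a b d; rewrite /strictly_open colliderC.
exists (rcons r t ++ c' :: w); split.
- by rewrite cat_path pr last_rcons; case: pw.
- by rewrite last_cat; case: pw.
have [s0 es] : exists s0, x :: r = rcons s0 c by rewrite lastI lr; exists (belast x r).
rewrite cat_rcons -cat_cons es cat_rcons chain_cat chain_cons3 cw andbT.
apply/andP; split; first by move: cr; rewrite -rcons_cons es -!cats1 -catA.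
by rewrite /strictly_open /collider ct ct' !inE eqxx orbT.
Qed.

Lemma sepS (F : digraph p) Z X Y X' Y' : X' \subset X -> Y' \subset Y -> sep F Z X Y ->
  sep F Z X' Y'.
Proof.
by move=> /subsetP XX /subsetP YY h x y /XX xX /YY; exact: h.
Qed.

(** If the last node t is one of the nodes to be separated, then in H it can be
traded for its parents outside Z: these are separated from Y as well, all of
this lives below t, and the local Markov property of t transfers the result to
t in G by weak union and contraction. *)
Lemma sound_last t Z X Y :
  (forall Z X Y, X \subset below pos (pos t) -> Y \subset below pos (pos t) ->
     Z \subset below pos (pos t) -> [disjoint X & Z] -> [disjoint Y & Z] ->
     sep H Z X Y -> sep G Z X Y) ->
  t \in X -> X :\ t \subset below pos (pos t) -> Y \subset below pos (pos t) ->
  Z \subset below pos (pos t) -> [disjoint X & Z] -> [disjoint Y & Z] ->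
  sep H Z X Y -> sep G Z X Y.
Proof.
move=> IH tX Xb Yb Zb XZ YZ hs.
have tY q : edge H q t -> q \notin Z -> q \notin Y.
  move=> qt qZ; apply/negP => qY; apply: (hs t q tX qY).
  by apply: connect_parent qt qZ _; exists [::].
have hsP : sep H Z (parents t :\: Z) Y.
  move=> q y; rewrite !inE => /andP[qZ qt] yY l.
  exact: (hs t y tX yY (connect_parent qt qZ l)).
have hP : sep G Z (parents t :\: Z) Y.
  apply: IH => //; last by rewrite disjoint_sym disjoints_subset setCD subsetUr.
  by apply: subset_trans (parents_below t); exact: subsetDl.
have hX : sep G Z (X :\ t) Y.
  apply: IH => //; last by apply: (sepS _ _ hs) => //; exact: subsetDl.
  by apply: disjointWl XZ; exact: subsetDl.
have ht : sep G Z [set t] Y.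
  apply/sepC; apply: sep_contraction (sepC hP) _; apply/sepC.
  have -> : Z :|: parents t :\: Z = parents t :|: Z :\: parents t.
    by apply/setP => c; rewrite !inE; case: (c \in Z); case: (edge H c t).
  apply: sep_weak_union; apply: (sepS (subxx _) _ (@local_markov t)).
  apply/subsetP => c; rewrite !inE => /orP[cY|/andP[nc cZ]].
    have /[!inE] -> := subsetP Yb c cY; rewrite andbT; apply/negP => ct.
    have cZ : c \notin Z by rewrite (disjointFr YZ cY).
    by have := tY c ct cZ; rewrite cY.
  by have /[!inE] -> := subsetP Zb c cZ; rewrite nc.
move=> x y xX; have [->|xt] := eqVneq x t; first by apply: ht; rewrite inE.
by apply: hX; rewrite !inE xt.
Qed.

(** If every missing edge of H is a separation of G given the other predecessors,
then every separation of H holds in G.  Induction on the level m, with t the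
node of level m: t is absent, or one of the separated nodes ([sound_last]), or
conditioned on.  In the last case X and Y are separated in H without t too,
since t could only have opened a collider at the top; and t is not connected in
H to both of them, since then [connect_join] would connect them given t.  So t
joins the side to which it may be connected, and weak union puts it back into
the conditioning set. *)
Lemma soundness m Z X Y : X \subset below pos m -> Y \subset below pos m ->
  Z \subset below pos m -> [disjoint X & Z] -> [disjoint Y & Z] ->
  sep H Z X Y -> sep G Z X Y.
Proof.
elim: m Z X Y => [|m IH] Z X Y Xm Ym Zm XZ YZ hs.
  by move=> x y /(subsetP Xm); rewrite inE.
have [t /eqP tm|not_m] := pickP (fun t => pos t == m); last first.
  have bm : below pos m.+1 = below pos m.
    by apply/setP => c; rewrite !inE ltnS leq_eqVlt not_m.
  by apply: (IH Z) => //; rewrite -bm.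
have bm W : W \subset below pos m.+1 -> t \notin W -> W \subset below pos m.
  move=> /subsetP Wm tW; apply/subsetP => c cW.
  have /[!inE] := Wm c cW; rewrite ltnS leq_eqVlt -tm => /orP[/eqP/pos_inj e|//].
  by rewrite -e cW in tW.
have bm' W : W \subset below pos m.+1 -> W :\ t \subset below pos m.
  by move=> Wm; apply: bm; rewrite ?inE ?eqxx//; apply: subset_trans Wm; exact: subsetDl.
have {}IH : forall Z X Y, X \subset below pos m.+1 -> Y \subset below pos m.+1 ->
    Z \subset below pos m.+1 -> [disjoint X & Z] -> [disjoint Y & Z] -> t \notin Z ->
    sep H Z X Y -> sep G Z X Y.
  move=> {hs XZ YZ Xm Ym Zm} {}Z {}X {}Y Xm Ym Zm XZ YZ tZ hs.
  have [tX|tX] := boolP (t \in X).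
    have tY : t \notin Y by apply/negP => tY; apply: (hs t t tX tY); exists [::].
    by apply: (@sound_last t); rewrite ?tm; auto.
  have [tY|tY] := boolP (t \in Y); last by apply: IH; auto.
  apply/sepC; apply: (@sound_last t); rewrite ?tm; auto.
  exact: sepC.
have [tZ|tZ] := boolP (t \in Z); last exact: IH.
have tX : t \notin X by rewrite (disjointFl XZ tZ).
have tY : t \notin Y by rewrite (disjointFl YZ tZ).
have eZ : Z = Z :\ t :|: [set t] by rewrite setUC setD1K.
have ltt W x : W \subset below pos m.+1 -> t \notin W -> x \in W -> (pos x < pos t)%N.
  by move=> Wm /(bm _ Wm)/subsetP h /h; rewrite inE tm.
have Zt : Z :\ t \subset below pos (pos t) by rewrite tm bm'.
(* a walk open without t never reaches t, hence is also open given t *)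
have hs' : sep H (Z :\ t) X Y.
  move=> x y xX yY [s [ps ls cs]]; apply: (hs x y xX yY); exists s; split => //.
  rewrite eZ; have st : t \notin s.
    apply/negP => /(stay_below pos_edge Zt (ltt _ _ Xm tX xX) _ ps cs).
    by rewrite ls inE ltnn => /(_ (ltt _ _ Ym tY yY)).
  have txs : t \notin x :: s.
    by rewrite inE negb_or st andbT; apply: contra tX => /eqP->.
  elim: (x :: s) cs txs => [//|a [|b [|c w]] IHw] //.
  rewrite !chain_cons3 => /andP[u cs]; rewrite inE negb_or => /andP[ta tw].
  rewrite IHw// andbT; move: u tw; rewrite /strictly_open !inE !negb_or eq_sym.
  by rewrite [b == t]eq_sym => /eqP-> /andP[/negbTE->]; rewrite orbF.
have tsub : [set t] \subset below pos m.+1.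
  by apply/subsetP => c /set1P->; rewrite inE tm.
have Zt' : t \notin Z :\ t by rewrite !inE eqxx.
have Zs : Z :\ t \subset below pos m.+1 by apply: subset_trans Zm; exact: subsetDl.
have dZ W : [disjoint W & Z] -> [disjoint W :|: [set t] & Z :\ t].
  move=> WZ; rewrite disjoints_subset; apply/subsetP => c; rewrite !inE.
  by case: eqVneq => //= _; rewrite orbF => cW; rewrite (disjointFr WZ cW).
have dZ' W : [disjoint W & Z] -> [disjoint W & Z :\ t].
  by move=> WZ; apply: disjointWr WZ; exact: subsetDl.
have [nxt|/existsNP[x0 /not_implyP[x0X /contrapT x0t]]] :=
    pselect (forall x, x \in X -> ~ dconnected H (Z :\ t) x t).
  rewrite eZ; apply: sep_weak_union; apply: IH => //; auto.
    by rewrite subUset Ym.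
  by move=> x y xX; rewrite !inE => /orP[|/eqP->]; [exact: hs'|exact: nxt].
apply/sepC; rewrite eZ; apply: sep_weak_union; apply: IH => //; auto.
  by rewrite subUset Xm.
move=> y x yY; rewrite !inE => /orP[xX|/eqP->]; first exact: (sepC hs').
move=> yt; apply: (hs x0 y x0X yY); rewrite eZ.
by apply: connect_join; eauto.
Qed.

End Soundness.

Section SparsestPermutation.
Import mathcomp.boot.fintype mathcomp.boot.finset.
Variable p : nat.
Implicit Types (G H : digraph p) (j k : 'I_p) (S : {set 'I_p}).
Implicit Types (pi : {perm 'I_p}) (dep : 'I_p -> 'I_p -> {set 'I_p} -> bool).

Definition dconnectedb G j k S : bool := `[< dconnected G S j k >].

Lemma dconnectedb_sym G j k S : dconnectedb G j k S = dconnectedb G k j S.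
Proof. by apply/asboolP/asboolP; exact: dconnected_sym. Qed.

Definition rank pi (x : 'I_p) : nat := (pi^-1)%g x.

Lemma rank_inj pi : injective (rank pi).
Proof. by move=> x y /val_inj/perm_inj. Qed.

Lemma rankK pi i : rank pi (pi i) = i.
Proof. by rewrite /rank permK. Qed.

Lemma sp_condE pi i k : sp_cond pi i k = (below (rank pi) k :\ pi i)%SET.
Proof.
rewrite /sp_cond; congr (_ :\ _); apply/setP => c; rewrite inE.
apply/imsetP/idP => [[d]|]; first by rewrite inE => dk ->; rewrite rankK.
by move=> ck; exists ((pi^-1)%g c); rewrite ?inE// permKV.
Qed.

Lemma edge_sp_graph dep pi i k :
  edge (sp_graph dep pi) (pi i) (pi k) =
  (i < k)%N && dep (pi i) (pi k) (below (rank pi) k :\ pi i)%SET.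
Proof.
apply/imsetP/andP => [[[i' k'] /=]|[ik d]].
  by rewrite inE /= sp_condE => /andP[ik d] [/perm_inj-> /perm_inj->].
by exists (i, k) => //; rewrite inE /= ik sp_condE.
Qed.

Lemma sp_graph_rank dep pi a b : edge (sp_graph dep pi) a b ->
  (rank pi a < rank pi b)%N.
Proof.
by rewrite -[a](permKV pi) -[b](permKV pi) edge_sp_graph !rankK => /andP[].
Qed.

Lemma sp_graph_dag dep pi : dag (sp_graph dep pi).
Proof. exact: pos_dag (@sp_graph_rank dep pi). Qed.

(** By construction the missing edges of the permutation graph are separations of
G given the other predecessors, which is what [soundness] asks for. *)
Lemma sp_graph_Imap G pi j k S : dag G -> ci_triple j k S ->
  dsep (sp_graph (dconnectedb G) pi) j k S -> dsep G j k S.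
Proof.
move=> dG /and3P[jk jS kS] dH; apply: not_dconnected_dsep => //.
have {dH} nH : ~ dconnected (sp_graph (dconnectedb G) pi) S j k.
  by move=> /(dconnected_not_dsep (sp_graph_dag _ _)).
have below_p (W : {set 'I_p}) : W \subset below (rank pi) p.
  by apply/subsetP => c _; rewrite inE /rank.
suff : sep G S [set j] [set k] by move=> h; apply: h; exact: set11.
apply: (soundness (@rank_inj pi) (@sp_graph_rank (dconnectedb G) pi) _
          (below_p _) (below_p _) (below_p S)); rewrite ?disjoints1//.
  move=> a b; rewrite -[a](permKV pi) -[b](permKV pi) edge_sp_graph !rankK.
  by move=> -> /= /asboolPn.
by move=> x y /set1P-> /set1P->.
Qed.

(** Sort the nodes by their number of ancestors. *)
Lemma topological_order G : dag G ->
  exists pi : {perm 'I_p}, forall a b, edge G a b -> (rank pi a < rank pi b)%N.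
Proof.
move=> dG; pose anc a := #|[set c | connect (edge G) c a]%SET|.
have anc_edge a b : edge G a b -> (anc a < anc b)%N.
  move=> ab; apply: proper_card; apply/properP; split.
    apply/subsetP => c; rewrite !inE => ca; apply: connect_trans ca _.
    exact: connect1.
  by exists b; rewrite !inE ?connect0//; exact: dag_edge.
pose s := sort (relpre anc leq) (enum 'I_p).
have ss : size s = p by rewrite size_sort size_enum_ord.
have us : uniq s by rewrite sort_uniq enum_uniq.
have ms a : a \in s by rewrite mem_sort mem_enum.
have lts a : (index a s < p)%N by rewrite -[X in (_ < X)%N]ss index_mem.
have inj : injective (fun a => Ordinal (lts a)).
  move=> a b [e]; rewrite -(nth_index a (ms a)) -(nth_index a (ms b)).
  by rewrite e.
exists (perm inj)^-1%g => a b ab; rewrite /rank invgK !permE /=.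
rewrite ltnNge; apply/negP => le.
have tr : transitive (relpre anc leq) by move=> ? ? ?; exact: leq_trans.
have tot : total (relpre anc leq) by move=> ? ?; exact: leq_total.
have rf : reflexive (relpre anc leq) by move=> ?; exact: leqnn.
have := sorted_leq_nth tr rf a (sort_sorted tot (enum 'I_p)).
move=> /(_ (index b s) (index a s)); rewrite !inE !index_mem !nth_index//.
by move=> /(_ (ms _) (ms _) le) /=; rewrite leqNgt anc_edge.
Qed.

(** Along a topological order of G, [ordered_markov] says that a non-edge of G is
a separation, so it is not added by the algorithm. *)
Lemma sp_graph_sub G : dag G ->
  exists pi : {perm 'I_p}, sp_graph (dconnectedb G) pi \subset G.
Proof.
move=> dG; have [pi pi_edge] := topological_order dG.
exists pi; apply/subsetP => -[a b].
rewrite -[a](permKV pi) -[b](permKV pi) => h.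
have : edge (sp_graph (dconnectedb G) pi) (pi ((pi^-1)%g a)) (pi ((pi^-1)%g b)) by [].
rewrite edge_sp_graph => /andP[lt_ab /asboolP c]; apply: contrapT => /negP nab.
apply: (ordered_markov (@rank_inj pi) pi_edge _ nab); rewrite !rankK//.
Qed.

(** An output has at most as many edges as the graph of a topological order of G,
hence as Gstar, and it is Markov with respect to everything G is. *)
Lemma sp_output_mec (R : realType) (lambda : R) (P : probability (p.-tuple R) R)
    (Gstar G : digraph p) :
  strong_SMR lambda P Gstar -> dag G -> markov_wrt G (Omega lambda P) ->
  (#|G| <= #|Gstar|)%N ->
  (sp_output (dconnectedb G) `<=` mec Gstar)%classic.
Proof.
move=> [_ smr] dG mG leG H [pi -> minH]; apply: contrapT => nmec.
have [pi0 sub] := sp_graph_sub dG.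
have mH : markov_wrt (sp_graph (dconnectedb G) pi) (Omega lambda P).
  by move=> j k S ci /(sp_graph_Imap dG ci); exact: mG.
have := smr _ (sp_graph_dag _ _) mH nmec.
by rewrite ltnNge (leq_trans (minH pi0) (leq_trans (subset_leq_card sub) leG)).
Qed.

End SparsestPermutation.

Local Open Scope classical_set_scope.
Local Open Scope ring_scope.

(** * Partial covariances as residual Gram forms *)
Section Gram.
Variables (R : rcfType) (p : nat).
Implicit Types (u v w a b : 'rV[R]_p) (W : 'M[R]_p) (e : R).

Definition bilform W u v : R := (u *m W *m v^T) 0 0.
Definition norm2 u : R := Num.sqrt (bilform 1%:M u u).

Lemma bilformE W u v : bilform W u v = \sum_j \sum_i u 0 i * W i j * v 0 j.
Proof.
rewrite /bilform mxE; apply: eq_bigr => j _; rewrite !mxE big_distrl /=.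
by apply: eq_bigr => i _.
Qed.

Lemma bilform1E u v : bilform 1%:M u v = \sum_i u 0 i * v 0 i.
Proof. by rewrite /bilform mulmx1 mxE; apply: eq_bigr => i _; rewrite mxE. Qed.

Lemma bilform1_ge0 u : 0 <= bilform 1%:M u u.
Proof. by rewrite bilform1E sumr_ge0// => i _; rewrite -expr2 sqr_ge0. Qed.

Lemma norm2_ge0 u : 0 <= norm2 u. Proof. exact: sqrtr_ge0. Qed.

Lemma sqr_norm2 u : norm2 u ^+ 2 = bilform 1%:M u u.
Proof. by rewrite sqr_sqrtr// bilform1_ge0. Qed.

Lemma norm2_eq0 u : norm2 u = 0 -> u = 0.
Proof.
move=> u0; apply/rowP => i; rewrite mxE; apply/eqP.
have := sqr_norm2 u; rewrite u0 expr0n /= bilform1E => /esym/eqP.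
rewrite psumr_eq0 => [/allP/(_ i)|j _]; last by rewrite -expr2 sqr_ge0.
by rewrite mem_index_enum => /(_ isT) /=; rewrite mulf_eq0 orbb.
Qed.

Lemma coord_le_norm2 u i : `|u 0 i| <= norm2 u.
Proof.
rewrite -sqrtr_sqr ler_wsqrtr// bilform1E (bigD1 i)//= -expr2 lerDl.
by rewrite sumr_ge0// => j _; rewrite -expr2 sqr_ge0.
Qed.

Lemma bilform_close W e u v : (forall i j, `|W i j - (i == j)%:R| <= e) ->
  `|bilform W u v - bilform 1%:M u v| <= e * (p ^ 2)%:R * (norm2 u * norm2 v).
Proof.
move=> We; have -> : bilform W u v - bilform 1%:M u v = bilform (W - 1%:M) u v.
  by rewrite /bilform mulmxBr mulmxBl !mxE.
rewrite bilformE; apply: le_trans (ler_norm_sum _ _ _) _.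
have -> : e * (p ^ 2)%:R * (norm2 u * norm2 v) =
    \sum_(j < p) \sum_(i < p) e * (norm2 u * norm2 v).
  by rewrite !sumr_const !card_ord -mulrnA mulnn -[RHS]mulr_natr mulrAC.
apply: ler_sum => j _; apply: le_trans (ler_norm_sum _ _ _) _.
apply: ler_sum => i _; rewrite !normrM mulrAC [X in X <= _]mulrC.
apply: ler_pM; rewrite ?mulr_ge0 ?normr_ge0//; first by rewrite !mxE; apply: We.
by apply: ler_pM; rewrite ?normr_ge0 ?coord_le_norm2.
Qed.

Section PartialCovariance.
Variables (m : nat) (B : 'M[R]_(m, p)).
Hypothesis B_free : row_free B.

(** With A W A^T for covariance matrix and B the rows of A indexed by S, this is
the partial covariance of the variables with rows u and v given S. *)
Definition residual_form W u v : R :=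
  bilform W u v - (u *m W *m B^T *m invmx (B *m W *m B^T) *m (B *m W *m v^T)) 0 0.

Local Notation gram W := (B *m W *m B^T).

(** Adding a linear combination of the conditioning variables does not change a
partial covariance; hence u and v may be replaced by their residuals for the
identity form, whatever W is. *)
Lemma residual_formDl W x u v : gram W \in unitmx ->
  residual_form W (u + x *m B) v = residual_form W u v.
Proof.
move=> uG; rewrite /residual_form /bilform !mulmxDl.
have -> : x *m B *m W *m B^T = x *m gram W by rewrite !mulmxA.
rewrite mulmxK// [x *m (B *m W *m v^T)]mulmxA [x *m (B *m W)]mulmxA.
by rewrite mxE [in X in _ - X]mxE opprD addrACA subrr addr0.
Qed.

Lemma residual_formC W u v : W^T = W -> residual_form W u v = residual_form W v u.
Proof.
move=> Ws; rewrite /residual_form /bilform.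
have tr00 (M : 'M[R]_1) : M 0 0 = M^T 0 0 by rewrite mxE.
congr (_ - _); rewrite [LHS]tr00 !trmx_mul ?trmx_inv ?trmx_mul !trmxK Ws ?mulmxA//.
Qed.

Lemma residual_formDr W x u v : W^T = W -> gram W \in unitmx ->
  residual_form W u (v + x *m B) = residual_form W u v.
Proof. by move=> Ws uG; rewrite residual_formC// residual_formDl// residual_formC. Qed.

Definition regression v : 'rV[R]_p :=
  v *m B^T *m invmx (B *m B^T) *m B.
Definition residual v : 'rV[R]_p := v - regression v.

Lemma gram1 : gram 1%:M = B *m B^T. Proof. by rewrite mulmx1. Qed.

Lemma unitmx_gram W : (forall v, v != 0 -> 0 < bilform W v v) -> gram W \in unitmx.
Proof.
move=> Wpos; rewrite -row_free_unit; apply/inj_row_free => x xG.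
apply/eqP; rewrite -(mulmx_free_eq0 _ B_free); apply/negP => /negP xB.
have := Wpos _ xB; rewrite /bilform trmx_mul mulmxA.
have -> : x *m B *m W *m B^T = x *m gram W by rewrite !mulmxA.
by rewrite xG mul0mx mxE ltxx.
Qed.

Lemma bilform1_gt0 v : v != 0 -> 0 < bilform 1%:M v v.
Proof.
move=> v0; rewrite lt_def bilform1_ge0 andbT; apply: contra v0 => /eqP h.
by apply/eqP/norm2_eq0; rewrite /norm2 h sqrtr0.
Qed.

Lemma unitmx_gram1 : B *m B^T \in unitmx.
Proof. by rewrite -gram1; apply: unitmx_gram; exact: bilform1_gt0. Qed.

Lemma residual_orth v : residual v *m B^T = 0.
Proof.
by rewrite /residual /regression mulmxBl -[_ *m B *m B^T]mulmxA mulmxKV ?unitmx_gram1// subrr.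
Qed.

Lemma residual_form_residual W u v : W^T = W -> gram W \in unitmx ->
  residual_form W u v = residual_form W (residual u) (residual v).
Proof.
move=> Ws uG; rewrite -{1}[u](subrK (regression u)) -{1}[v](subrK (regression v)).
by rewrite /regression residual_formDl// residual_formDr.
Qed.

Lemma residual_form1 u v : residual_form 1%:M u v = bilform 1%:M (residual u) (residual v).
Proof.
rewrite residual_form_residual ?trmx1// ?gram1 ?unitmx_gram1//.
by rewrite /residual_form mulmx1 residual_orth !mul0mx mxE subr0.
Qed.

(** The error is relative to the lengths of the residuals, with a constant that
does not depend on B.  For residuals u' and v' the second term of the form is
the product of u' with w, the W-orthogonal projection of v' on the row space of
B.  Since v' is orthogonal to that space for the identity form, w is of order e;
since u' is orthogonal to it as well, the product is of order e^2. *)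
Lemma residual_form_close W e u v : W^T = W -> 0 <= e -> e < 1 ->
  (forall u v, `|bilform W u v - bilform 1%:M u v| <= e * (norm2 u * norm2 v)) ->
  `|residual_form W u v - bilform 1%:M (residual u) (residual v)|
    <= e / (1 - e) * (norm2 (residual u) * norm2 (residual v)).
Proof.
move=> Ws e0 e1 We.
have Wpos w : w != 0 -> 0 < bilform W w w.
  move=> w0; have := We w w; rewrite -expr2 sqr_norm2 ler_distl => /andP[+ _].
  have := bilform1_gt0 w0; nra.
have uG := unitmx_gram Wpos.
rewrite residual_form_residual//.
set u' := residual u; set v' := residual v.
pose z := v' *m W *m B^T *m invmx (gram W); pose w := z *m B.
have wv : bilform 1%:M u' w = 0.
  by rewrite /bilform mulmx1 /w trmx_mul mulmxA residual_orth mul0mx mxE.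
have vw : bilform 1%:M v' w = 0.
  by rewrite /bilform mulmx1 /w trmx_mul mulmxA residual_orth mul0mx mxE.
have -> : residual_form W u' v' = bilform W u' v' - bilform W u' w.
  rewrite /residual_form /bilform; congr (_ - _).
  by rewrite /w /z !trmx_mul trmx_inv !trmx_mul !trmxK Ws !mulmxA.
have ww : bilform W w w = bilform W v' w.
  have zG : z *m gram W = v' *m W *m B^T by rewrite /z mulmxKV.
  rewrite /bilform /w trmx_mul [v' *m W *m _]mulmxA -zG.
  by rewrite !mulmxA.
(* |w|^2 (1 - e) <= W w w = W v' w <= e |v'| |w| *)
have nw : norm2 w * (1 - e) <= e * norm2 v'.
  have := We w w; rewrite -!expr2 ww sqr_norm2 ler_distl => /andP[h1 _].
  have := We v' w; rewrite vw subr0 => /(le_trans (ler_norm _)) h2.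
  rewrite -sqr_norm2 in h1.
  have := norm2_ge0 w; rewrite le_eqVlt => /orP[/eqP<-|w0].
    by rewrite mul0r mulr_ge0 ?norm2_ge0.
  rewrite -(ler_pM2r w0); nra.
have e1' : 0 < 1 - e by lra.
have h1 := We u' v'; have := We u' w; rewrite wv subr0 => h2.
rewrite addrAC; apply: (le_trans (ler_normB _ _)).
apply: (le_trans (lerD h1 h2)).
have -> : e / (1 - e) = e + e * (e / (1 - e)) by field; rewrite gt_eqF.
rewrite mulrDl lerD2l -mulrA ler_wpM2l// mulrCA ler_wpM2l ?norm2_ge0//.
by rewrite mulrAC ler_pdivlMr.
Qed.

End PartialCovariance.

(** Here s_u and s_v are the population standard deviations and the j's the
sample partial covariances, known up to a relative error k.  A zero covariance leads
to a sample correlation at most k / (1 - k), and a correlation above lambda to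
one above (lambda - k) / (1 + k); the choice k = lambda / (2 + lambda) makes both
bounds equal to lambda / 2, the threshold of the test. *)
Lemma correlation_test_accept (l k su sv juv juu jvv : R) :
  0 < l -> k = l / (2 + l) -> 0 <= su -> 0 <= sv ->
  `|juv| <= k * (su * sv) ->
  `|juu - su ^+ 2| <= k * (su * su) -> `|jvv - sv ^+ 2| <= k * (sv * sv) ->
  4 * juv ^+ 2 <= l ^+ 2 * (juu * jvv).
Proof.
move=> l0 kE su0 sv0 huv; rewrite !ler_distl => /andP[huu _] /andP[hvv _].
have l2 : 0 < 2 + l by lra.
have k1 : 1 - k = 2 / (2 + l) by rewrite kE; field; lra.
have kl : 2 * k = l * (1 - k) by rewrite k1 kE; field; lra.
have k10 : 0 < 1 - k by rewrite k1 divr_gt0.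
have uu : (1 - k) * su ^+ 2 <= juu by rewrite mulrBl mul1r expr2 in huu *.
have vv : (1 - k) * sv ^+ 2 <= jvv by rewrite mulrBl mul1r expr2 in hvv *.
have -> : 4 * juv ^+ 2 = (2 * `|juv|) ^+ 2 by rewrite exprMn real_normK ?num_real//; ring.
apply: (@le_trans _ _ ((l * (1 - k) * (su * sv)) ^+ 2)).
  apply: lerXn2r; rewrite ?nnegrE ?mulr_ge0//; [exact: ltW|exact: ltW|].
  by rewrite -kl -mulrA ler_pM2l.
have -> : (l * (1 - k) * (su * sv)) ^+ 2 =
  l ^+ 2 * (((1 - k) * su ^+ 2) * ((1 - k) * sv ^+ 2)) by ring.
by rewrite ler_wpM2l ?sqr_ge0// ler_pM// mulr_ge0 ?sqr_ge0 ?ltW.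
Qed.

Lemma correlation_test_reject (l k su sv s juv juu jvv : R) :
  0 < l -> k = l / (2 + l) -> 0 < su -> 0 < sv ->
  l * (su * sv) < `|s| ->
  `|juv - s| <= k * (su * sv) ->
  `|juu - su ^+ 2| <= k * (su * su) -> `|jvv - sv ^+ 2| <= k * (sv * sv) ->
  l ^+ 2 * (juu * jvv) < 4 * juv ^+ 2.
Proof.
move=> l0 kE su0 sv0 hs huv; rewrite !ler_distl => /andP[huu' huu] /andP[hvv' hvv].
have l2 : 0 < 2 + l by lra.
have k0 : 0 < k by rewrite kE divr_gt0.
have k1 : 1 - k = 2 / (2 + l) by rewrite kE; field; lra.
have k10 : 0 < 1 - k by rewrite k1 divr_gt0.
have kl : 2 * (l - k) = l * (1 + k) by rewrite kE; field; lra.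
have ss : 0 < su * sv by rewrite mulr_gt0.
have juu0 : 0 <= juu by apply: le_trans huu'; rewrite -expr2; have := sqr_ge0 su; nra.
have jvv0 : 0 <= jvv by apply: le_trans hvv'; rewrite -expr2; have := sqr_ge0 sv; nra.
have uu : juu <= (1 + k) * su ^+ 2 by rewrite mulrDl mul1r expr2 in huu *.
have vv : jvv <= (1 + k) * sv ^+ 2 by rewrite mulrDl mul1r expr2 in hvv *.
have huv' : (l - k) * (su * sv) < `|juv|.
  have := ler_normD (juv) (s - juv); rewrite addrC subrK distrC => h.
  lra.
have -> : 4 * juv ^+ 2 = (2 * `|juv|) ^+ 2 by rewrite exprMn real_normK ?num_real//; ring.
apply: (@le_lt_trans _ _ ((l * (1 + k) * (su * sv)) ^+ 2)); last first.
  apply: ltrXn2r => //; last by rewrite -kl -mulrA ltr_pM2l.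
  by rewrite !mulr_ge0 ?ltW// addr_gt0.
have -> : (l * (1 + k) * (su * sv)) ^+ 2 =
  l ^+ 2 * (((1 + k) * su ^+ 2) * ((1 + k) * sv ^+ 2)) by ring.
by rewrite ler_wpM2l ?sqr_ge0// ler_pM.
Qed.

End Gram.

(** * The test statistic *)

Section TestStatistic.
Variables (R : rcfType) (p : nat).
Implicit Types (M W A : 'M[R]_p) (j k : 'I_p) (S : {set 'I_p}).

Definition subset_mx M S : 'M[R]_#|S| := mxsub enum_val enum_val M.

(** The partial covariance multiplied by the determinant of the covariance matrix
of X_S.  It is a polynomial in the entries of M, so it is measurable, and the
factor cancels in the comparison made by the test. *)
Definition scaled_partial_cov M j k S : R :=
  \det (subset_mx M S) * M j k -
  ((\row_b M j (enum_val b)) *m \adj (subset_mx M S) *m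
   (\col_b M (enum_val b) k)) 0 0.

Definition accepts (l : R) M j k S : bool :=
  4 * scaled_partial_cov M j k S ^+ 2 <=
  l ^+ 2 * (scaled_partial_cov M j j S * scaled_partial_cov M k k S).

Definition rows A S : 'M[R]_(#|S|, p) := rowsub enum_val A.

Lemma rows_free A S : A \in unitmx -> row_free (rows A S).
Proof.
move=> uA; rewrite /row_free /rows; apply/eqP.
have := uA; rewrite -row_free_unit => fA.
rewrite rowsubE mxrankMfree//.
apply/eqP; rewrite -[_ == _]/(row_free _); apply/row_freeP.
exists (\matrix_(i, a) (i == enum_val a)%:R).
apply/matrixP => a b; rewrite !mxE (bigD1 (enum_val b)) //= !mxE eqxx mulr1.
rewrite big1 => [|i /negbTE ib]; last by rewrite !mxE ib mulr0.
by rewrite addr0 (inj_eq enum_val_inj).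
Qed.

Lemma gramE A W j k : (A *m W *m A^T) j k = bilform W (row j A) (row k A).
Proof. by rewrite /bilform -row_mul !mxE; apply: eq_bigr => i _; rewrite !mxE. Qed.

Lemma gram_rows A W S :
  rows A S *m W *m (rows A S)^T = subset_mx (A *m W *m A^T) S.
Proof. by rewrite /rows trmx_mxsub /subset_mx mxsub_mul -[in RHS]mul_rowsub_mx. Qed.

Lemma gram_row A W j S : \row_b (A *m W *m A^T) j (enum_val b) =
  row j A *m W *m (rows A S)^T.
Proof.
apply/rowP => b; rewrite -row_mul [LHS]mxE [LHS]mxE [RHS]mxE.
by apply: eq_bigr => i _; rewrite /rows !mxE.
Qed.

Lemma gram_col A W k S : \col_b (A *m W *m A^T) (enum_val b) k =
  rows A S *m W *m (row k A)^T.
Proof.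
rewrite /rows mul_rowsub_mx; apply/colP => b.
rewrite [LHS]mxE [LHS]mxE [RHS]mxE.
by apply: eq_bigr => i _; rewrite /rows !mxE.
Qed.

Lemma residual_form_gram A W j k S :
  residual_form (rows A S) W (row j A) (row k A) =
  (A *m W *m A^T) j k -
  ((\row_b (A *m W *m A^T) j (enum_val b)) *m invmx (subset_mx (A *m W *m A^T) S)
   *m (\col_b (A *m W *m A^T) (enum_val b) k)) 0 0.
Proof. by rewrite /residual_form gram_rows gram_row gram_col gramE. Qed.

Lemma scaled_partial_covE A W j k S :
  rows A S *m W *m (rows A S)^T \in unitmx ->
  scaled_partial_cov (A *m W *m A^T) j k S =
  \det (subset_mx (A *m W *m A^T) S) * residual_form (rows A S) W (row j A) (row k A).
Proof.
rewrite residual_form_gram gram_rows /scaled_partial_cov => uS.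
rewrite mulrBr /invmx uS -scalemxAr -scalemxAl; congr (_ - _).
by rewrite [in RHS]mxE mulVKr.
Qed.

(** The bound lambda / (2 (1 + lambda)) on W - 1 is the e for which the relative
error e / (1 - e) of the residual forms is lambda / (2 + lambda). *)
Lemma accepts_gram (l : R) A W S : 0 < l -> A \in unitmx -> W^T = W ->
  (forall u v : 'rV[R]_p, `|bilform W u v - bilform 1%:M u v| <=
     l / (2 * (1 + l)) * (norm2 u * norm2 v)) ->
  let u j := residual (rows A S) (row j A) in
  forall j k,
  (bilform 1%:M (u j) (u k) = 0 -> accepts l (A *m W *m A^T) j k S) /\
  (l * (norm2 (u j) * norm2 (u k)) < `|bilform 1%:M (u j) (u k)| ->
     0 < norm2 (u j) -> 0 < norm2 (u k) -> ~~ accepts l (A *m W *m A^T) j k S).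
Proof.
move=> l0 uA Ws We u j k; have B_free := rows_free S uA.
set e := l / (2 * (1 + l)) in We.
have l1 : 0 < 1 + l by rewrite addr_gt0.
have e0 : 0 < e by rewrite divr_gt0// mulr_gt0.
have e1 : e < 1 by rewrite ltr_pdivrMr ?mulr_gt0// mul1r; lra.
have kE : e / (1 - e) = l / (2 + l).
  by rewrite /e; clear -l0; field; do ?(apply/andP; split); lra.
have close j' k' := residual_form_close B_free (row j' A) (row k' A) Ws (ltW e0) e1 We.
have uG : rows A S *m W *m (rows A S)^T \in unitmx.
  apply: (unitmx_gram B_free) => v v0.
  have := We v v; rewrite -expr2 sqr_norm2 ler_distl => /andP[h _].
  apply: lt_le_trans h; have := bilform1_gt0 v0.
  by rewrite -{2}[bilform _ _ _]mul1r -mulrBl => fv; rewrite mulr_gt0// subr_gt0.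
rewrite /accepts !scaled_partial_covE//.
set D := \det _; have D0 : 0 < D ^+ 2.
  rewrite lt_def sqr_ge0 sqrf_eq0 andbT -unitfE.
  by move: uG; rewrite gram_rows.
have -> x y z : (4 * (D * x) ^+ 2 <= l ^+ 2 * (D * y * (D * z))) =
    (4 * x ^+ 2 <= l ^+ 2 * (y * z)).
  rewrite -[RHS](ler_pM2l D0); congr (_ <= _); ring.
rewrite kE in close.
have cjj := close j j; have ckk := close k k; rewrite -sqr_norm2 in cjj.
rewrite -sqr_norm2 in ckk; have cjk := close j k.
split=> [h|h uj uk].
  rewrite h subr0 in cjk.
  exact: (correlation_test_accept l0 erefl (norm2_ge0 _) (norm2_ge0 _) cjk cjj ckk).
rewrite -ltNge.
exact: (correlation_test_reject l0 erefl uj uk h cjk cjj ckk).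
Qed.

End TestStatistic.

Section PopulationCorrelation.
Variables (R : realType) (p : nat) (P : probability (p.-tuple R) R) (A : 'M[R]_p).
Hypotheses (uA : A \in unitmx) (covA : Defs.cov P = A *m A^T).

Local Notation u S j := (residual (rows A S) (row j A)).

Lemma partial_cov_gram j k S : partial_cov P j k S = bilform 1%:M (u S j) (u S k).
Proof.
rewrite -residual_form1 ?rows_free// residual_form_gram mulmx1 -covA.
by rewrite /partial_cov; congr (_ - (_ *m invmx _ *m _) 0 0).
Qed.

Lemma partial_corr_gram j k S :
  partial_corr P j k S = bilform 1%:M (u S j) (u S k) / (norm2 (u S j) * norm2 (u S k)).
Proof. by rewrite /partial_corr !partial_cov_gram. Qed.

(** If a residual has length zero then the population partial correlation is
0 by the convention on division, so rejection only concerns residuals of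
positive length. *)
Lemma accepts_correct (l : R) W j k S : 0 < l -> W^T = W ->
  (forall a b : 'rV[R]_p, `|bilform W a b - bilform 1%:M a b| <=
     l / (2 * (1 + l)) * (norm2 a * norm2 b)) ->
  (partial_cov P j k S = 0 -> accepts l (A *m W *m A^T) j k S) /\
  (accepts l (A *m W *m A^T) j k S -> `|partial_corr P j k S| <= l).
Proof.
move=> l0 Ws We; have [h1 h2] := accepts_gram S l0 uA Ws We j k.
split; first by rewrite partial_cov_gram.
apply: contraTT; rewrite -ltNge partial_corr_gram normrM normfV.
rewrite [`|_ * _|]ger0_norm ?mulr_ge0 ?norm2_ge0// => h.
have n0 : 0 < norm2 (u S j) * norm2 (u S k).
  rewrite lt_def mulr_ge0 ?norm2_ge0// andbT; apply/eqP => e.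
  by move: h; rewrite e invr0 mulr0 ltNge ltW.
have nj : norm2 (u S j) != 0 by apply: contraTneq n0 => ->; rewrite mul0r ltxx.
have nk : norm2 (u S k) != 0 by apply: contraTneq n0 => ->; rewrite mulr0 ltxx.
by apply: h2; rewrite -?ltr_pdivlMr// lt_def ?nj ?nk norm2_ge0.
Qed.

End PopulationCorrelation.

(** * Image measures and translations of the normal law *)
Section IntegralTransfer.
Local Open Scope ereal_scope.
Import HBNNSimple.

Section Transfer.
Context d d' (T : measurableType d) (Y : measurableType d') (R : realType).
Variables (m : {measure set T -> \bar R}) (phi : T -> Y) (w : T -> R).
Hypotheses (mphi : measurable_fun [set: T] phi) (mw : measurable_fun [set: T] w).
Let mEw : measurable_fun [set: T] (EFin \o w).
Proof. exact/measurable_EFinP. Qed.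
Hypothesis (w0 : forall x, (0 <= w x)%R).

Lemma integral_weight_sfun (g : {nnsfun Y >-> R}) :
  \int[m]_x ((g (phi x))%:E * (w x)%:E) =
  \sum_(k \in range g) (k%:E * \int[m]_(x in phi @^-1` (g @^-1` [set k])) (w x)%:E).
Proof.
have mpre k : measurable (phi @^-1` (g @^-1` [set k])).
  by rewrite -[X in measurable X]setTI; apply: mphi => //; exact: measurable_funPTI.
have mr k : measurable_fun [set: T] ((EFin \o w) \_ (phi @^-1` (g @^-1` [set k]))).
  by apply: (measurable_restrictT _ _).1 => //; exact: measurable_funTS.
transitivity (\int[m]_x (\sum_(k \in range g)
    (k%:E * ((EFin \o w) \_ (phi @^-1` (g @^-1` [set k])) x)))).
  apply: eq_integral => x _.
  rewrite (fsbigD1 (g (phi x)))// fsbig1 => [|k [_ /= gk]].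
    by rewrite /= adde0 patchE ifT// inE.
  rewrite patchE; case: ifPn; last by rewrite mule0.
  by rewrite inE => /= e; case: gk.
rewrite ge0_integral_fsum//.
- apply: eq_fsbigr => k; rewrite inE => -[y _ <-].
  rewrite ge0_integralZl//.
  + by rewrite -integral_mkcond.
  + by move=> x _; apply: erestrict_ge0 => z _; rewrite lee_fin.
  + by rewrite lee_fin.
- by move=> k; exact: emeasurable_funM.
- move=> k x _; have [k0|k0] := ltP k 0%R.
    by rewrite preimage_nnfun0// preimage_set0 patchE memNset ?mule0.
  by apply: mule_ge0; [rewrite lee_fin|apply: erestrict_ge0 => z _; rewrite lee_fin].
Qed.

Lemma integral_weight_lim (f : Y -> \bar R) (mf : measurable_fun [set: Y] f) :
  (forall y, 0 <= f y) -> let g := nnsfun_approx measurableT mf in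
  \int[m]_x (f (phi x) * (w x)%:E) = limn (fun n => \sum_(k \in range (g n))
     (k%:E * \int[m]_(x in phi @^-1` (g n @^-1` [set k])) (w x)%:E)).
Proof.
move=> f0 g; under [in RHS]eq_fun do rewrite -integral_weight_sfun.
rewrite -monotone_convergence//.
- apply: eq_integral => x _; apply/esym/cvg_lim => //.
  by apply: cvgeZr => //; exact: cvg_nnsfun_approx.
- move=> n; apply/measurable_EFinP/measurable_funM => //.
  exact: measurableT_comp.
- by move=> n x _; rewrite mule_ge0 ?lee_fin.
- move=> x _ a b ab; apply: lee_wpmul2r; rewrite lee_fin//.
  exact/lefP/nd_nnsfun_approx.
Qed.

End Transfer.

(** Two weighted image measures that agree on measurable sets integrate
nonnegative functions alike.  Stated with weights, so that it applies to
densities and to versions of conditional probabilities without having to build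
the measures they define; the proof goes through simple functions. *)
Lemma ge0_integral_transfer d1 d2 d (T1 : measurableType d1)
    (T2 : measurableType d2) (Y : measurableType d) (R : realType)
    (m1 : {measure set T1 -> \bar R}) (m2 : {measure set T2 -> \bar R})
    (phi1 : T1 -> Y) (phi2 : T2 -> Y) (w1 : T1 -> R) (w2 : T2 -> R) :
  measurable_fun [set: T1] phi1 -> measurable_fun [set: T2] phi2 ->
  measurable_fun [set: T1] w1 -> measurable_fun [set: T2] w2 ->
  (forall x, (0 <= w1 x)%R) -> (forall x, (0 <= w2 x)%R) ->
  (forall B, measurable B -> \int[m1]_(x in phi1 @^-1` B) (w1 x)%:E =
                             \int[m2]_(x in phi2 @^-1` B) (w2 x)%:E) ->
  forall f : Y -> \bar R, measurable_fun [set: Y] f -> (forall y, 0 <= f y) ->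
  \int[m1]_x (f (phi1 x) * (w1 x)%:E) = \int[m2]_x (f (phi2 x) * (w2 x)%:E).
Proof.
move=> mp1 mp2 mw1 mw2 w10 w20 h f mf f0.
rewrite !(integral_weight_lim _ _ _ _ mf)//; congr (limn _); apply/funext => n.
by apply: eq_fsbigr => k _; rewrite h//; exact: measurable_funPTI.
Qed.

Lemma integral_cst1 d (T : measurableType d) (R : realType)
    (m : {measure set T -> \bar R}) (A : set T) : measurable A ->
  \int[m]_(x in A) (cst 1%R x)%:E = m A.
Proof.
move=> mA; have -> : \int[m]_(x in A) (cst 1%R x)%:E = \int[m]_(x in A) cst 1 x by [].
by rewrite integral_cst// mul1e.
Qed.

Lemma ge0_integral_image d1 d2 (T1 : measurableType d1) (T2 : measurableType d2)
    (R : realType) (m1 : {measure set T1 -> \bar R}) (m2 : {measure set T2 -> \bar R})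
    (phi : T2 -> T1) : measurable_fun [set: T2] phi ->
  (forall B, measurable B -> m1 B = m2 (phi @^-1` B)) ->
  forall f : T1 -> \bar R, measurable_fun [set: T1] f -> (forall y, 0 <= f y) ->
  \int[m1]_x f x = \int[m2]_x f (phi x).
Proof.
move=> mphi h f mf f0.
have := @ge0_integral_transfer _ _ _ T1 T2 T1 R m1 m2 id phi (cst 1%R) (cst 1%R).
move=> /(_ _ mphi (measurable_cst _) (measurable_cst _)) H.
transitivity (\int[m1]_x (f x * 1%:E)); first by apply: eq_integral => x _; rewrite mule1.
rewrite H//; first by apply: eq_integral => x _; rewrite mule1.
move=> B mB; rewrite !integral_cst1// ?h//.
by rewrite -[X in measurable X]setTI; exact: mphi.
Qed.

Section GaussianLine.
Variable R : realType.
Notation mu := lebesgue_measure.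
Notation N := (@normal_prob R 0 1).

Lemma lebesgue_measure_translate (c : R) (A : set R) : measurable A ->
  mu ((fun x : measurableTypeR R => x + c)%R @^-1` A) = mu A.
Proof.
pose f := (fun x : measurableTypeR R => x + c)%R : _ -> measurableTypeR R.
have mf : measurable_fun [set: measurableTypeR R] f by exact: measurable_funD.
pose f' : {mfun measurableTypeR R >-> measurableTypeR R} := HB.pack f
  (isMeasurableFun.Build _ _ _ _ f mf).
move=> mA; apply/esym.
apply: (lebesgue_measure_unique (mu := pushforward mu f')) mA => _ [[a b]] _ <-.
rewrite -[RHS]/(mu (f @^-1` `]a, b]%classic)).
rewrite (_ : f @^-1` _ = `](a - c)%R, (b - c)%R]%classic); last first.
  by apply/seteqP; split => x /=; rewrite /f !in_itv /= ltrBlDr lerBrDr.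
rewrite [RHS]lebesgue_measure_itv [LHS]lebesgue_measure_itv /= !lte_fin ltrD2r.
by case: ifP => // _; rewrite -!EFinB; congr EFin; ring.
Qed.

Lemma ge0_integral_translate (c : R) (f : R -> \bar R) :
  measurable_fun [set: R] f -> (forall x, 0 <= f x) ->
  \int[mu]_x f (x + c)%R = \int[mu]_x f x.
Proof.
move=> mf f0; apply/esym.
apply: (@ge0_integral_image _ _ (measurableTypeR R) (measurableTypeR R) R mu mu (fun x => x + c)%R) => //.
  exact: measurable_funD.
by move=> B mB; exact/esym/lebesgue_measure_translate.
Qed.

Lemma ge0_integral_normal (f : R -> \bar R) :
  measurable_fun [set: R] f -> (forall x, 0 <= f x) ->
  \int[N]_x f x = \int[mu]_x (f x * (normal_pdf 0 1 x)%:E).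
Proof.
move=> mf f0.
transitivity (\int[N]_x (f x * 1%:E)); first by apply: eq_integral => x _; rewrite mule1.
apply: (@ge0_integral_transfer _ _ _ _ _ R R N mu id id (cst 1%R) (normal_pdf 0 1)) => //.
- exact: measurable_normal_pdf.
- exact: normal_pdf_ge0.
- by move=> B mB; rewrite integral_cst1.
Qed.

(** The density of the standard normal law at x - c is its density at x times
exp (c x - c^2 / 2). *)
Lemma normal_translate (c : R) (f : R -> \bar R) :
  measurable_fun [set: R] f -> (forall x, 0 <= f x) ->
  \int[N]_x f (x + c)%R = \int[N]_x (f x * (expR (c * x - c ^+ 2 / 2))%:E).
Proof.
move=> mf f0.
have mE : measurable_fun [set: R] (fun x => expR (c * x - c ^+ 2 / 2)).
  by apply: measurableT_comp => //; exact: measurable_funB.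
have mt : measurable_fun [set: R] (fun x : R => f (x + c)%R).
  by apply: (measurableT_comp mf); exact: measurable_funD.
etransitivity; first exact: (ge0_integral_normal mt).
etransitivity; last first.
  apply/esym; apply: ge0_integral_normal.
  - by apply: emeasurable_funM => //; exact/measurable_EFinP.
  - by move=> x; rewrite mule_ge0// lee_fin expR_ge0.
rewrite -[RHS](ge0_integral_translate c); last 2 first.
- apply: emeasurable_funM; last by apply/measurable_EFinP; exact: measurable_normal_pdf.
  by apply: emeasurable_funM => //; exact/measurable_EFinP.
- by move=> x; rewrite !mule_ge0// lee_fin ?expR_ge0 ?normal_pdf_ge0.
apply: eq_integral => x _; rewrite -muleA -EFinM; congr (_ * _%:E).
rewrite !normal_pdfE ?oner_neq0//= /normal_fun mulrCA -expRD.
by congr (_ * expR _)%R; field.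
Qed.

End GaussianLine.

Lemma ge0_integral_iid_cons d (T : measurableType d) (R : realType)
    (P : probability T R) n (F : n.+1.-tuple T -> \bar R) :
  measurable_fun [set: n.+1.-tuple T] F -> (forall z, 0 <= F z) ->
  \int[iid P n.+1]_z F z = \int[P]_x \int[iid P n]_z F (iid_cons (x, z)).
Proof.
move=> mF F0.
rewrite (@ge0_integral_image _ _ _ _ R _ (P \x iid P n) (@iid_cons d T n))//.
rewrite fubini_tonelli1//.
exact: (measurableT_comp mF (@measurable_iid_cons d T n)).
Qed.

Section CameronMartin.
Variable R : realType.
Notation N := (@normal_prob R 0 1).

Definition shift p (u : 'I_p -> R) (z : p.-tuple R) : p.-tuple R :=
  [tuple (tnth z i + u i)%R | i < p].

Definition linform p (u : 'I_p -> R) (z : p.-tuple R) : R :=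
  (\sum_(i < p) u i * tnth z i)%R.

Lemma measurable_shift p u : measurable_fun [set: p.-tuple R] (@shift p u).
Proof.
apply/measurable_fun_tnthP => i.
rewrite (_ : _ \o _ = fun z => (tnth z i + u i)%R); last first.
  by apply/funext => z /=; rewrite tnth_mktuple.
by apply: measurable_funD => //; exact: measurable_tnth.
Qed.

Lemma measurable_linform p u : measurable_fun [set: p.-tuple R] (@linform p u).
Proof.
apply: measurable_sum => i; apply: measurable_funM => //; exact: measurable_tnth.
Qed.

Lemma shift_cons p (u : 'I_p.+1 -> R) x (z : p.-tuple R) :
  shift u (iid_cons (x, z)) =
  iid_cons ((x + u ord0)%R, shift (fun i => u (lift ord0 i)) z).
Proof.
apply: eq_from_tnth => i; rewrite tnth_mktuple.
case: (unliftP ord0 i) => [j|] ->; last by rewrite !tnth0.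
by rewrite !tnthS tnth_mktuple.
Qed.

Lemma linform_cons p (u : 'I_p.+1 -> R) x (z : p.-tuple R) :
  linform u (iid_cons (x, z)) = (u ord0 * x + linform (fun i => u (lift ord0 i)) z)%R.
Proof.
rewrite /linform big_ord_recl tnth0; congr (_ + _)%R.
by apply: eq_bigr => i _; rewrite tnthS.
Qed.

(** The translation formula one coordinate at a time, by Tonelli. *)
Lemma cameron_martin p (u : 'I_p -> R) (F : p.-tuple R -> \bar R) :
  measurable_fun [set: p.-tuple R] F -> (forall z, 0 <= F z) ->
  \int[iid N p]_z F (shift u z) =
  \int[iid N p]_z (F z * (expR (linform u z - (\sum_i u i ^+ 2) / 2))%:E).
Proof.
elim: p u F => [|p IH] u F mF F0.
  apply: eq_integral => z _; rewrite /linform !big_ord0 mul0r subr0 expR0 mule1.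
  by congr F; apply: eq_from_tnth => -[].
have mS := measurable_shift u.
have mcons := @measurable_iid_cons _ R p.
pose u' i := u (lift ord0 i).
pose s' := (\sum_i u' i ^+ 2)%R.
pose E z := (expR (linform u' z - s' / 2))%:E.
have mE : measurable_fun [set: p.-tuple R] E.
  apply/measurable_EFinP; apply: measurableT_comp => //.
  by apply: measurable_funB => //; exact: measurable_linform.
have mEu : measurable_fun [set: p.+1.-tuple R]
   (fun z => (expR (linform u z - (\sum_i u i ^+ 2) / 2))%:E).
  apply/measurable_EFinP; apply: measurableT_comp => //.
  by apply: measurable_funB => //; exact: measurable_linform.
rewrite ge0_integral_iid_cons//; last exact: (measurableT_comp mF).
rewrite [RHS]ge0_integral_iid_cons//; last 2 first.
- exact: emeasurable_funM.
- by move=> z; rewrite mule_ge0// lee_fin expR_ge0.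
pose G x := \int[iid N p]_z (F (iid_cons (x, z)) * E z).
have mFx x : measurable_fun [set: p.-tuple R] (fun z => F (iid_cons (x, z))).
  exact: (measurableT_comp (measurableT_comp mF mcons) (measurable_pair1 x)).
transitivity (\int[N]_x G (x + u ord0)%R).
  apply: eq_integral => x _; under eq_integral do rewrite shift_cons.
  exact: (IH u' (fun z => F (iid_cons ((x + u ord0)%R, z)))).
have mFE : measurable_fun [set: R * p.-tuple R] (fun xz => F (iid_cons xz) * E xz.2).
  by apply: emeasurable_funM; [exact: (measurableT_comp mF)|exact: (measurableT_comp mE)].
have G0 x : 0 <= G x.
  by apply: integral_ge0 => z _; rewrite mule_ge0// lee_fin expR_ge0.
rewrite normal_translate//; last first.
  apply: (@measurable_fun_fubini_tonelli_F _ _ _ _ R (iid N p) _ mFE) => xz.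
  by rewrite mule_ge0// lee_fin expR_ge0.
apply: eq_integral => x _; rewrite /G -ge0_integralZr//.
- apply: eq_integral => z _; rewrite -muleA -EFinM; congr (_ * _%:E).
  rewrite -expRD linform_cons big_ord_recl; congr expR; rewrite -/u' -/s'.
  by field.
- by apply: emeasurable_funM => //; exact: mFx.
- by move=> z _; apply: mule_ge0 => //; rewrite lee_fin expR_ge0.
Qed.

End CameronMartin.

End IntegralTransfer.

(** * Conditional independence given a subvector *)
Section SubvectorSigmaAlgebra.
Variables (R : realType) (p : nat).
Notation RV := (p.-tuple R).
Implicit Types (S : {set 'I_p}) (C D : set RV) (x y : RV).

Definition subvector S (x : RV) : #|S|.-tuple R := [tuple tnth x (enum_val i) | i < #|S|].

Lemma measurable_subvector S : measurable_fun [set: RV] (subvector S).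
Proof.
apply/measurable_fun_tnthP => i.
rewrite (_ : _ \o _ = fun x => tnth x (enum_val i)); first exact: measurable_tnth.
by apply/funext => x /=; rewrite tnth_mktuple.
Qed.

Lemma sigma_coordP S (C : set RV) : sigma_coord S C <->
  exists2 D : set (#|S|.-tuple R), measurable D & C = subvector S @^-1` D.
Proof.
rewrite /sigma_coord.
have -> : (fun i : 'I_#|S| => Defs.coord (enum_val i)) =
    (fun i => (fun y : #|S|.-tuple R => tnth y i) \o (subvector S : RV -> _)).
  by apply/funext => i; apply/funext => x; rewrite /Defs.coord /= tnth_mktuple.
rewrite g_sigma_preimage_comp; split => [[D mD <-]|[D mD ->]].
  by exists D; rewrite ?setTI.
by exists D; rewrite ?setTI.
Qed.

Lemma sigma_coord_measurable S C : sigma_coord S C -> measurable C.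
Proof.
by move=> /sigma_coordP[D mD ->]; rewrite -[X in measurable X]setTI; exact: measurable_subvector.
Qed.

Lemma sigma_coordI S C D : sigma_coord S C -> sigma_coord S D -> sigma_coord S (C `&` D).
Proof.
move=> /sigma_coordP[C' mC ->] /sigma_coordP[D' mD ->]; apply/sigma_coordP.
by exists (C' `&` D') => //; exact: measurableI.
Qed.

(** Measurability for the sigma-algebra of X_S, which is a set of sets and not the
sigma-algebra carried by the type. *)
Definition sigma_fun S (h : RV -> R) := forall B, measurable B -> sigma_coord S (h @^-1` B).

Lemma sigma_fun_measurable S h : sigma_fun S h -> measurable_fun [set: RV] h.
Proof. by move=> hS _ B mB; rewrite setTI; apply: sigma_coord_measurable (hS _ _). Qed.

Lemma sigma_fun_eq S h x y : sigma_fun S h -> subvector S x = subvector S y -> h x = h y.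
Proof.
move=> hS xy; have /sigma_coordP[D mD e] := hS [set h x] (measurable_set1 _).
have : (h @^-1` [set h x]) x by [].
by rewrite e /preimage /= xy -[D _]/((subvector S @^-1` D) y) -e => ->.
Qed.

Lemma sigma_fun_comp S (psi : #|S|.-tuple R -> R) :
  measurable_fun setT psi -> sigma_fun S (psi \o subvector S).
Proof.
move=> mpsi B mB; apply/sigma_coordP; exists (psi @^-1` B) => //.
by rewrite -[X in measurable X]setTI; exact: mpsi.
Qed.

End SubvectorSigmaAlgebra.

Section ConditionalVersions.
Variables (R : realType) (p : nat) (P : probability (p.-tuple R) R) (S : {set 'I_p}).
Notation RV := (p.-tuple R).
Notation F := (sigma_coord S).
Implicit Types (E : set RV) (f h : RV -> R).

(** Versions of conditional probabilities may be negative on a null set; their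
positive parts are the versions to which statements on nonnegative functions
apply. *)
Definition pospart f x : R := Num.max (f x) 0.

Lemma pospart_ge0 f x : 0 <= pospart f x. Proof. by rewrite le_max lexx orbT. Qed.

Lemma sigma_fun_pospart f : sigma_fun S f -> sigma_fun S (pospart f).
Proof.
move=> fS B mB; have := fS ((fun y : R => Num.max y 0) @^-1` B); apply.
rewrite -[X in measurable X]setTI.
by apply: (measurable_maxr (@measurable_id _ _ _) (measurable_cst _)).
Qed.

(** The version integrates to a nonnegative number over the set where it is
negative, so E has probability zero there. *)
Lemma version_pospart E f (C : set RV) : measurable E -> cond_prob_version P F E f -> F C ->
  (\int[P]_(x in C) (pospart f x)%:E)%E = P (E `&` C).
Proof.
move=> mE [fS /integrableP[/measurable_EFinP mf _] fE] FC.
have Fpos : F (f @^-1` `[0, +oo[%classic) by apply: fS.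
have Fneg : F (f @^-1` `]-oo, 0[%classic) by apply: fS.
have neg0 : P (E `&` f @^-1` `]-oo, 0[%classic) = 0%E.
  apply/eqP; rewrite eq_le measure_ge0 andbT -fE//.
  under eq_integral do rewrite -[f _]opprK EFinN.
  have fneg x : (f @^-1` `]-oo, 0[%classic) x -> (0 <= (- f x)%:E)%E.
    by rewrite /= in_itv /= lee_fin oppr_ge0 => /ltW.
  by rewrite integral_ge0N// oppe_le0; exact: integral_ge0.
have mC := sigma_coord_measurable FC.
have mpos := sigma_coord_measurable Fpos.
have mneg := sigma_coord_measurable Fneg.
transitivity (\int[P]_(x in C `&` f @^-1` `[0%R, +oo[%classic) (f x)%:E)%E.
  rewrite integral_mkcondr; apply: eq_integral => x _.
  rewrite patchE; have [f0|f0] := leP 0 (f x).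
    by rewrite mem_set /= ?in_itv /= ?andbT// /pospart (max_idPl f0).
  rewrite memNset /= ?in_itv /= ?andbT /pospart ?(max_idPr (ltW f0))//.
  by apply/negP; rewrite -ltNge.
rewrite fE; last exact: sigma_coordI.
rewrite [RHS](_ : _ = P ((E `&` (C `&` f @^-1` `[0%R, +oo[%classic)) `|`
  (C `&` (E `&` f @^-1` `]-oo, 0%R[%classic))))%E; last first.
  congr (P _); apply/seteqP; split => x /=.
    move=> [Ex Cx]; have [f0|f0] := leP 0 (f x).
      by left; rewrite in_itv /= andbT.
    by right; rewrite in_itv.
  by move=> [[? []]|[? []]].
rewrite measureU//; last 3 first.
- by apply: measurableI => //; exact: measurableI.
- by apply: measurableI => //; exact: measurableI.
- apply/seteqP; split => // x [[_ [_ /=]]] + [_ [_ /=]].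
  by rewrite !in_itv /= andbT leNgt => /negP.
rewrite [X in (_ + X)%E](_ : _ = 0%E) ?adde0//.
apply/eqP; rewrite eq_le measure_ge0 andbT -neg0; apply: le_measure; rewrite ?inE.
- by apply: measurableI => //; exact: measurableI.
- exact: measurableI.
- by move=> x [].
Qed.

(** The defining property of a version, extended from indicators of sets in the
sigma-algebra to nonnegative measurable functions. *)
Lemma version_integral E f h : measurable E -> cond_prob_version P F E f -> sigma_fun S h ->
  (\int[P]_x ((pospart h x)%:E * (pospart f x)%:E) = \int[P]_x ((pospart h x)%:E * (\1_E x)%:E))%E.
Proof.
move=> mE vf hS; have [fS _ _] := vf.
have mpf := sigma_fun_measurable (sigma_fun_pospart fS).
pose g y := (Num.max (y : R) 0)%:E.
have mh := sigma_fun_measurable hS.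
apply: (@ge0_integral_transfer _ _ _ _ _ R R P P h h (pospart f) \1_E mh mh mpf _ _ _ _ g).
- exact: measurable_indic.
- exact: pospart_ge0.
- by [].
- move=> B mB; have hB := sigma_coord_measurable (hS _ mB).
  by rewrite (version_pospart mE vf (hS _ mB)) integral_indic.
- by apply/measurable_EFinP; apply: measurable_maxr => //; exact: measurable_cst.
- by move=> y; rewrite /g lee_fin le_max lexx orbT.
Qed.

End ConditionalVersions.

Section CIExponential.
Variables (R : realType) (p : nat) (P : probability (p.-tuple R) R) (S : {set 'I_p}).
Notation RV := (p.-tuple R).
Notation F := (sigma_coord S).

Lemma version_prod (A B : set RV) f g : measurable A -> measurable B ->
  cond_prob_version P F A f -> cond_prob_version P F B g ->
  cond_prob_version P F (A `&` B) (f \* g) ->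
  P (A `&` B) = (\int[P]_x ((pospart f x)%:E * (pospart g x)%:E))%E.
Proof.
move=> mA mB vf vg vfg; have [fS _ _] := vf; have [gS _ _] := vg.
have null E h : measurable E -> cond_prob_version P F E h ->
    P (E `&` h @^-1` `]-oo, 0[%classic) = 0%E.
  move=> mE vh; have [hS _ _] := vh.
  rewrite -(version_pospart mE vh); last exact: hS.
  rewrite (eq_integral (cst 0%E)) ?integral0// => x.
  rewrite inE /= in_itv /= => /ltW h0; by rewrite /pospart (max_idPr h0).
(* off C, where f or g is negative, A or B has probability zero *)
pose C := f @^-1` `[0, +oo[%classic `&` g @^-1` `[0, +oo[%classic.
have FC : F C by apply: sigma_coordI; [exact: fS|exact: gS].
have mC := sigma_coord_measurable FC.
have mN1 : measurable (A `&` f @^-1` `]-oo, 0[%classic).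
  by apply: measurableI => //; apply: sigma_coord_measurable (fS _ _).
have mN2 : measurable (B `&` g @^-1` `]-oo, 0[%classic).
  by apply: measurableI => //; apply: sigma_coord_measurable (gS _ _).
have mAB := measurableI _ _ mA mB.
transitivity (P (A `&` B `&` C)).
  apply/eqP; rewrite eq_le; apply/andP; split; last first.
    by apply: le_measure; rewrite ?inE//; exact: measurableI.
  rewrite -(measureU0 (measurableI _ _ mAB mC) mN1 (null _ _ mA vf)).
  rewrite -(measureU0 (measurableU _ _ (measurableI _ _ mAB mC) mN1) mN2 (null _ _ mB vg)).
  apply: le_measure; rewrite ?inE//.
    by do !apply: measurableU => //; exact: measurableI.
  move=> x [Ax Bx]; rewrite /C /= !in_itv /= !andbT.
  have [f0|f0] := leP 0 (f x); last by left; right.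
  have [g0|g0] := leP 0 (g x); last by right.
  by left; left.
rewrite -(version_pospart mAB vfg FC) integral_mkcond; apply: eq_integral => x _.
rewrite patchE -EFinM; have [f0|f0] := leP 0 (f x); last first.
  rewrite memNset; first by rewrite {1}/pospart (max_idPr (ltW f0)) mul0r.
  by move=> [/=]; rewrite in_itv /= andbT leNgt f0.
have [g0|g0] := leP 0 (g x); last first.
  rewrite memNset; first by rewrite [pospart g x]/pospart (max_idPr (ltW g0)) mulr0.
  by move=> [_ /=]; rewrite in_itv /= andbT leNgt g0.
rewrite mem_set; last by split; rewrite /= in_itv /= andbT.
by rewrite /pospart (max_idPl f0) (max_idPl g0) (max_idPl (mulr_ge0 f0 g0)).
Qed.

Variables (j k : 'I_p).
Hypothesis ci : cond_indep P j k S.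

Lemma measurable_coord (i : 'I_p) : measurable_fun [set: RV] (Defs.coord (R := R) i).
Proof. exact: measurable_tnth. Qed.

Lemma measurable_coord_preimage (i : 'I_p) (A : set R) : measurable A ->
  measurable (Defs.coord i @^-1` A : set RV).
Proof. by move=> mA; rewrite -[X in measurable X]setTI; exact: measurable_coord. Qed.

(** The joint law of X_j and the event X_k in B is the law of X_j weighted by the
conditional probability of that event.  The point is that one version g serves
all A, whereas the assumption provides a version for each pair A, B. *)
Lemma cond_indep_weight (B : set R) : measurable B -> exists2 g : RV -> R,
  cond_prob_version P F (Defs.coord k @^-1` B) g &
  forall A, measurable A -> P (Defs.coord j @^-1` A `&` Defs.coord k @^-1` B) =
    (\int[P]_(x in Defs.coord j @^-1` A) (pospart g x)%:E)%E.
Proof.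
move=> mB; have [f0 [g0 [_ v0 _]]] := ci measurableT mB; exists g0 => // A mA.
have [f [g [vf vg vfg]]] := ci mA mB.
have mA' := measurable_coord_preimage j mA; have mB' := measurable_coord_preimage k mB.
have [fS _ _] := vf; have [g0S _ _] := v0.
rewrite (version_prod mA' mB' vf vg vfg).
rewrite (version_integral mB' vg fS) -(version_integral mB' v0 fS).
under eq_integral do rewrite muleC.
rewrite (version_integral mA' vf g0S) [RHS]integral_mkcond.
apply: eq_integral => x _; rewrite patchE indicE.
by case: (x \in _); rewrite ?mule1 ?mule0.
Qed.

(** If, against functions of X_S, exp X_j integrates like c_j exp L_j and exp X_k
like c_k exp L_k, then under conditional independence both replacements can be
made in exp (X_j + X_k), one after the other: by [cond_indep_weight] an event on
X_k acts on exp X_j as a function of X_S. *)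
Lemma cond_indep_expR (Lj Lk : RV -> R) (cj ck : R) : sigma_fun S Lj -> sigma_fun S Lk ->
  0 <= cj -> 0 <= ck ->
  (forall h : RV -> R, sigma_fun S h -> (forall x, (0 <= h x)%R) ->
     \int[P]_x ((h x)%:E * (expR (Defs.coord j x))%:E) =
     cj%:E * \int[P]_x ((h x)%:E * (expR (Lj x))%:E))%E ->
  (forall h : RV -> R, sigma_fun S h -> (forall x, (0 <= h x)%R) ->
     \int[P]_x ((h x)%:E * (expR (Defs.coord k x))%:E) =
     ck%:E * \int[P]_x ((h x)%:E * (expR (Lk x))%:E))%E ->
  (\int[P]_x (expR (Defs.coord j x + Defs.coord k x))%:E =
   cj%:E * (ck%:E * \int[P]_x (expR (Lj x + Lk x))%:E))%E.
Proof.
move=> LjS LkS cj0 ck0 Hj Hk.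
have mj := measurable_coord j; have mk := measurable_coord k.
have mexp (h : RV -> R) : measurable_fun setT h -> measurable_fun setT (expR \o h).
  by move=> mh; apply: measurableT_comp.
have mLj := sigma_fun_measurable LjS.
have expS (h : RV -> R) : sigma_fun S h -> sigma_fun S (fun x => expR (h x)).
  move=> hS B mB; apply: (hS (expR @^-1` B)).
  rewrite -[X in measurable X]setTI; exact: measurable_expR.
have mexpR : measurable_fun setT (fun y : R => (expR y)%:E).
  by apply/measurable_EFinP; exact: measurable_expR.
have exp_pos (h : RV -> R) x : pospart (fun x => expR (h x)) x = expR (h x).
  by rewrite /pospart; apply/max_idPl; exact: expR_ge0.
have stepB (B : set R) : measurable B ->
  (\int[P]_(x in Defs.coord k @^-1` B) (expR (Defs.coord j x))%:E =
   cj%:E * \int[P]_(x in Defs.coord k @^-1` B) (expR (Lj x))%:E)%E.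
  move=> mB; have [g vg Hg] := cond_indep_weight mB.
  have mB' := measurable_coord_preimage k mB; have [gS _ _] := vg.
  have indB (h : RV -> R) : (\int[P]_(x in Defs.coord k @^-1` B) (expR (h x))%:E =
      \int[P]_x ((expR (h x))%:E * (\1_(Defs.coord k @^-1` B) x)%:E))%E.
    rewrite integral_mkcond; apply: eq_integral => x _; rewrite patchE indicE.
    by case: (x \in _); rewrite ?mule1 ?mule0.
  rewrite indB.
  transitivity (\int[P]_x ((expR (Defs.coord j x))%:E * (pospart g x)%:E))%E.
    apply: (@ge0_integral_transfer _ _ _ _ _ R R P P _ _ _ _ mj mj _ _ _ _ _
              (fun y => (expR y)%:E)) => //.
    - exact: sigma_fun_measurable (sigma_fun_pospart gS).
    - exact: pospart_ge0.
    - move=> A mA; rewrite -Hg// integral_indic//; first by rewrite setIC.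
      exact: measurable_coord_preimage.
  under eq_integral do rewrite muleC.
  rewrite Hj; [|exact: sigma_fun_pospart|exact: pospart_ge0].
  congr (_ * _)%E; under eq_integral do rewrite muleC -exp_pos.
  rewrite (version_integral mB' vg (expS _ LjS)).
  by rewrite indB; apply: eq_integral => x _; rewrite exp_pos.
transitivity (\int[P]_x ((expR (Defs.coord k x))%:E * (cj * expR (Lj x))%:E))%E.
  under eq_integral do rewrite expRD mulrC EFinM.
  apply: (@ge0_integral_transfer _ _ _ _ _ R R P P _ _ _ _ mk mk _ _ _ _ _
            (fun y => (expR y)%:E)) => //.
  - exact: mexp.
  - by apply: measurable_funM => //; exact: mexp.
  - by move=> x; rewrite mulr_ge0 ?expR_ge0.
  - move=> B mB; rewrite stepB//; under [RHS]eq_integral do rewrite EFinM.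
    rewrite ge0_integralZl//.
    + exact: measurable_coord_preimage.
    + by apply/measurable_EFinP; apply: measurable_funTS; exact: mexp.
under eq_integral do rewrite EFinM muleCA.
have m1 : measurable_fun [set: RV]
    (fun x => (expR (Defs.coord k x))%:E * (expR (Lj x))%:E)%E.
  by apply: emeasurable_funM; apply/measurable_EFinP; exact: mexp.
have p1 x : [set: RV] x -> (0 <= (expR (Defs.coord k x))%:E * (expR (Lj x))%:E)%E.
  by move=> _; rewrite mule_ge0// lee_fin expR_ge0.
rewrite (ge0_integralZl _ measurableT m1 p1) ?lee_fin//.
congr (_ * _)%E; under eq_integral do rewrite muleC.
rewrite Hk; [|exact: expS|by move=> x; exact: expR_ge0].
by congr (_ * _)%E; apply: eq_integral => x _; rewrite -EFinM -expRD.
Qed.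

End CIExponential.

(** * Conditional independence in a Gaussian vector *)

Section GaussianVector.
Variables (R : realType) (p : nat) (P : probability (p.-tuple R) R).
Variables (mu : 'cV[R]_p) (A : 'M[R]_p).
Notation RV := (p.-tuple R).
Notation gauss := (iid (@normal_prob R 0 1) p).
Notation aff := (Defs.affine mu A).
Hypothesis uA : A \in unitmx.
Hypothesis PE : forall B : set RV, measurable B -> P B = gauss (aff @^-1` B).

Lemma tnth_affine z i : tnth (aff z) i = mu i 0 + linform (fun l => A i l) z.
Proof.
rewrite tnth_mktuple !mxE; congr (_ + _).
by apply: eq_bigr => l _; rewrite !mxE.
Qed.

Lemma measurable_affine : measurable_fun [set: RV] aff.
Proof.
apply/measurable_fun_tnthP => i.
rewrite (_ : _ \o _ = fun z => mu i 0 + linform (fun l => A i l) z).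
  by apply: measurable_funD => //; exact: measurable_linform.
by apply/funext => z /=; rewrite tnth_affine.
Qed.

Lemma ge0_integral_gaussian (f : RV -> \bar R) :
  measurable_fun [set: RV] f -> (forall x, 0 <= f x)%E ->
  (\int[P]_x f x = \int[gauss]_z f (aff z))%E.
Proof.
move=> mf f0.
exact: (@ge0_integral_image _ _ RV (p.-tuple (measurableTypeR R)) R P gauss aff
  measurable_affine PE f mf f0).
Qed.

Variable S : {set 'I_p}.
Notation B := (rows A S).

Lemma tnth_subvector (x : RV) b : tnth (subvector S x) b = tnth x (enum_val b).
Proof. by rewrite tnth_mktuple. Qed.

Lemma linform_shift (a u : 'I_p -> R) z : linform a (shift u z) = linform a z + \sum_i a i * u i.
Proof.
rewrite /linform -big_split; apply: eq_bigr => i _ /=.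
by rewrite tnth_mktuple mulrDr.
Qed.

(** A shift of Z orthogonal to the rows of the conditioning variables leaves X_S
unchanged. *)
Lemma subvector_shift (u : 'rV[R]_p) z : u *m B^T = 0 ->
  subvector S (aff (shift (u 0) z)) = subvector S (aff z).
Proof.
move=> uB; apply: eq_from_tnth => b; rewrite !tnth_subvector !tnth_affine linform_shift.
have /matrixP/(_ 0 b) := uB; rewrite [LHS]mxE [RHS]mxE => h.
rewrite (eq_bigr (fun i => u 0 i * B^T i b)) ?h ?addr0// => i _.
by rewrite !mxE mulrC.
Qed.

(** If Y = L + u . Z with u orthogonal to the conditioning rows, then the factor
exp (u . Z) can be absorbed in a shift of Z along u, which does not affect
functions of X_S; it contributes exp (|u|^2 / 2). *)
Lemma expR_orthogonal (Y L h : RV -> R) (u : 'rV[R]_p) : u *m B^T = 0 ->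
  measurable_fun [set: RV] Y -> (forall z, Y (aff z) = L (aff z) + linform (u 0) z) ->
  sigma_fun S L -> sigma_fun S h -> (forall x, 0 <= h x) ->
  (\int[P]_x ((h x)%:E * (expR (Y x))%:E) =
   (expR (bilform 1%:M u u / 2))%:E * \int[P]_x ((h x)%:E * (expR (L x))%:E))%E.
Proof.
move=> uB mY YL LS hS h0.
have mL := sigma_fun_measurable LS; have mh := sigma_fun_measurable hS.
have me (f : RV -> R) : measurable_fun [set: RV] f ->
    measurable_fun [set: RV] (fun x => (h x)%:E * (expR (f x))%:E)%E.
  move=> mf; apply: emeasurable_funM; apply/measurable_EFinP => //.
  by apply: measurableT_comp => //; exact: measurable_expR.
have e0 (f : RV -> R) x : (0 <= (h x)%:E * (expR (f x))%:E)%E.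
  by rewrite mule_ge0// lee_fin// expR_ge0.
rewrite !ge0_integral_gaussian//; try exact: me.
pose G z := ((h (aff z))%:E * (expR (L (aff z)))%:E)%E.
have mG : measurable_fun [set: RV] G.
  exact: (measurableT_comp (me _ mL) measurable_affine).
have Gs z : G (shift (u 0) z) = G z.
  by rewrite /G (sigma_fun_eq hS (subvector_shift z uB)) (sigma_fun_eq LS (subvector_shift z uB)).
have G0 z : (0 <= G z)%E by exact: e0.
have := cameron_martin (u 0) mG G0; under eq_integral do rewrite Gs.
move=> /= GE; rewrite -/G.
transitivity (\int[gauss]_z ((expR (bilform 1%:M u u / 2))%:E *
    (G z * (expR (linform (u 0) z - (\sum_i u 0 i ^+ 2) / 2))%:E)))%E.
  apply: eq_integral => z _; rewrite YL expRD EFinM muleA.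
  rewrite -/(G z) [RHS]muleCA -[in RHS]EFinM -expRD; congr (_ * (expR _)%:E)%E.
  rewrite bilform1E; under [X in X / 2]eq_bigr do rewrite -expr2.
  by rewrite addrCA subrr addr0.
have mE : measurable_fun [set: RV]
    (fun z => G z * (expR (linform (u 0) z - (\sum_i u 0 i ^+ 2) / 2))%:E)%E.
  apply: (emeasurable_funM mG); apply/measurable_EFinP.
  apply: measurableT_comp; first exact: measurable_expR.
  exact: (measurable_funB (measurable_linform _) (measurable_cst _)).
have E0 z : [set: RV] z ->
    (0 <= G z * (expR (linform (u 0) z - (\sum_i u 0 i ^+ 2) / 2))%:E)%E.
  by move=> _; apply: mule_ge0; [exact: G0|rewrite lee_fin expR_ge0].
have c0 : (0 <= (expR (bilform 1%:M u u / 2))%:E)%E by rewrite lee_fin expR_ge0.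
by rewrite (ge0_integralZl gauss measurableT mE E0 c0) -GE.
Qed.

Lemma integral_expR_affine (Y : RV -> R) (c : R) (w : 'rV[R]_p) :
  measurable_fun [set: RV] Y -> (forall z, Y (aff z) = c + linform (w 0) z) ->
  (\int[P]_x (expR (Y x))%:E = (expR (c + bilform 1%:M w w / 2))%:E)%E.
Proof.
move=> mY YE; rewrite ge0_integral_gaussian//; last first.
  by apply/measurable_EFinP; apply: measurableT_comp => //; exact: measurable_expR.
have := cameron_martin (w 0) (measurable_cst 1%E) (fun=> lee01).
rewrite integral_cst// mul1e => /= h.
have -> : expR (c + bilform 1%:M w w / 2) = expR (c + bilform 1%:M w w / 2) * 1 by rewrite mulr1.
rewrite EFinM -[1%:E](@probability_setT _ _ R gauss) h -ge0_integralZl//.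
- apply: eq_integral => z _; rewrite mul1e -EFinM -expRD YE; congr (expR _)%:E.
  rewrite bilform1E; under [X in _ + X / 2 + _]eq_bigr do rewrite -expr2.
  by ring.
- apply: emeasurable_funM => //; apply/measurable_EFinP; apply: measurableT_comp => //.
  by apply: measurable_funB => //; exact: measurable_linform.
Qed.

(** The best linear predictor of X_i from X_S. *)
Definition predictor (i : 'I_p) (x : RV) : R :=
  mu i 0 + \sum_b (row i A *m B^T *m invmx (B *m B^T)) 0 b *
     (tnth (subvector S x) b - mu (enum_val b) 0).

Lemma predictor_measurable i : exists2 psi : #|S|.-tuple R -> R,
  measurable_fun setT psi & predictor i = psi \o subvector S.
Proof.
exists (fun y : #|S|.-tuple R => mu i 0 + \sum_b
  (row i A *m B^T *m invmx (B *m B^T)) 0 b * (tnth y b - mu (enum_val b) 0)) => //.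
apply: measurable_funD => //; apply: measurable_sum => b; apply: measurable_funM => //.
by apply: measurable_funB => //; exact: measurable_tnth.
Qed.

Lemma predictor_sigma i : sigma_fun S (predictor i).
Proof. by have [psi mpsi ->] := predictor_measurable i; exact: sigma_fun_comp. Qed.

Lemma predictor2_sigma i j : sigma_fun S (predictor i \+ predictor j).
Proof.
have [psi mpsi ->] := predictor_measurable i.
have [psi' mpsi' ->] := predictor_measurable j.
by apply: (@sigma_fun_comp _ _ S (psi \+ psi')); exact: measurable_funD.
Qed.

Lemma coord_predictor i z : Defs.coord i (aff z) =
  predictor i (aff z) + linform (residual B (row i A) 0) z.
Proof.
rewrite /Defs.coord tnth_affine /predictor -addrA; congr (_ + _).
pose c := row i A *m B^T *m invmx (B *m B^T); rewrite -/c.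
have cE l : A i l = residual B (row i A) 0 l + \sum_b c 0 b * A (enum_val b) l.
  have /matrixP/(_ 0 l) := subrK (regression B (row i A)) (row i A).
  rewrite [LHS]mxE [RHS]mxE => <-; congr (_ + _).
  by rewrite /regression mxE; apply: eq_bigr => b _; rewrite !mxE.
rewrite (eq_bigr (fun b => \sum_l c 0 b * A (enum_val b) l * tnth z l)); last first.
  move=> b _; rewrite tnth_subvector tnth_affine addrAC subrr add0r /linform mulr_sumr.
  by apply: eq_bigr => l _; rewrite mulrA.
rewrite exchange_big addrC /linform -big_split; apply: eq_bigr => l _ /=.
by rewrite cE mulrDl mulr_suml.
Qed.

Lemma expR_halves_eq (a b c x : R) :
  ((expR (a / 2))%:E * (expR x)%:E =
   (expR (b / 2))%:E * ((expR (c / 2))%:E * (expR x)%:E))%E -> a = b + c.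
Proof. by rewrite -!EFinM -!expRD => -[] /expR_inj h; lra. Qed.

(** The mean of exp (X_j + X_k) is computed in two ways: through conditional
independence, and directly, by a shift along u + v.  All the other factors
agree, so |u + v|^2 = |u|^2 + |v|^2. *)
Lemma cond_indep_orthogonal j k : cond_indep P j k S ->
  bilform 1%:M (residual B (row j A)) (residual B (row k A)) = 0.
Proof.
move=> ci; set u := residual B (row j A); set v := residual B (row k A).
have B_free := rows_free S uA.
have uB : u *m B^T = 0 by exact: residual_orth.
have vB : v *m B^T = 0 by exact: residual_orth.
have mj := @measurable_coord R p j; have mk := @measurable_coord R p k.
have LjS := predictor_sigma j; have LkS := predictor_sigma k.
have H := cond_indep_expR ci LjS LkS (expR_ge0 _) (expR_ge0 _)
  (fun h hS h0 => expR_orthogonal uB mj (coord_predictor j) LjS hS h0)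
  (fun h hS h0 => expR_orthogonal vB mk (coord_predictor k) LkS hS h0).
have mS (f g : RV -> R) : measurable_fun [set: RV] f -> measurable_fun [set: RV] g ->
  measurable_fun [set: RV] (f \+ g) by move=> mf mg; exact: measurable_funD.
have mLj := sigma_fun_measurable LjS; have mLk := sigma_fun_measurable LkS.
pose wj := row j A - u; pose wk := row k A - v.
have LE i z : predictor i (aff z) =
    mu i 0 + linform ((row i A - residual B (row i A)) 0) z.
  apply: (addIr (linform (residual B (row i A) 0) z)).
  rewrite -coord_predictor /Defs.coord tnth_affine -addrA /linform -big_split /=.
  by congr (_ + _); apply: eq_bigr => l _; rewrite -mulrDl !mxE subrK.
have lin2 (a b : 'rV[R]_p) z : linform (a 0) z + linform (b 0) z = linform ((a + b) 0) z.
  by rewrite /linform -big_split; apply: eq_bigr => l _; rewrite !mxE mulrDl.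
have IE := @integral_expR_affine (predictor j \+ predictor k) (mu j 0 + mu k 0) (wj + wk)
  (mS _ _ mLj mLk).
have E2 : (\int[P]_x (expR (Defs.coord j x + Defs.coord k x))%:E =
   (expR (bilform 1%:M (u + v) (u + v) / 2))%:E *
     \int[P]_x (expR (predictor j x + predictor k x))%:E)%E.
  have h1 : sigma_fun S (cst 1 : RV -> R).
    exact: (@sigma_fun_comp _ _ S (cst 1) (measurable_cst _)).
  have uvB : (u + v) *m B^T = 0 by rewrite mulmxDl uB vB addr0.
  have := expR_orthogonal uvB (mS _ _ mj mk) (L := predictor j \+ predictor k) _
            (predictor2_sigma j k) h1 (fun=> ler01).
  move=> /(_ _) E; under eq_integral do rewrite -[(expR _)%:E]mul1e.
  rewrite E => [|z /=]; last first.
    by rewrite !coord_predictor addrACA lin2.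
  by congr (_ * _)%E; apply: eq_integral => x _; rewrite mul1e.
move: H; rewrite E2 IE => [|z /=]; last first.
  by rewrite !LE addrACA lin2.
set s := mu j 0 + _ + _.
move=> /expR_halves_eq.
have -> : bilform 1%:M (u + v) (u + v) =
    bilform 1%:M u u + bilform 1%:M v v + 2 * bilform 1%:M u v.
  rewrite !bilform1E mulr_sumr -!big_split; apply: eq_bigr => i _ /=.
  by rewrite !mxE; ring.
by move=> /eqP; rewrite -subr_eq0 addrAC subrr add0r mulf_eq0 pnatr_eq0 /= => /eqP.
Qed.

End GaussianVector.

(** * Means and the weak law of large numbers *)
Section HasMean.
Context d (T : measurableType d) (R : realType) (P : probability T R).
Implicit Types (f g : T -> R).

(** Integrability and value together, so that one rule per operation suffices to
compute expectations. *)
Definition has_mean f r : Prop :=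
  P.-integrable [set: T] (EFin \o f) /\ (\int[P]_x (f x)%:E)%E = r%:E.

Lemma has_mean_measurable f r : has_mean f r -> measurable_fun [set: T] f.
Proof. by move=> [/integrableP[/measurable_EFinP]]. Qed.

Lemma has_mean_cst r : has_mean (cst r) r.
Proof.
split; first exact: finite_measure_integrable_cst.
have -> : (\int[P]_x (cst r x)%:E)%E = (\int[P]_x (cst r%:E x))%E by [].
rewrite integral_cst// -[RHS]mule1; congr (_ * _)%E; exact: probability_setT.
Qed.

Lemma has_meanD f g a b : has_mean f a -> has_mean g b -> has_mean (f \+ g) (a + b).
Proof.
move=> [fi fE] [gi gE]; split.
  by rewrite (_ : _ \o _ = (EFin \o f) \+ (EFin \o g))%E//; exact: integrableD.
under eq_integral do rewrite EFinD.
by rewrite integralD// fE gE.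
Qed.

Lemma has_meanZ f a c : has_mean f a -> has_mean (fun x => c * f x) (c * a).
Proof.
move=> [fi fE]; split.
  by rewrite (_ : _ \o _ = fun x => c%:E * (EFin \o f) x)%E//; exact: integrableZl.
under eq_integral do rewrite EFinM.
by rewrite integralZl// fE.
Qed.

Lemma has_meanB f g a b : has_mean f a -> has_mean g b ->
  has_mean (fun x => f x - g x) (a - b).
Proof.
move=> hf hg; have := has_meanD hf (has_meanZ (-1) hg).
by rewrite mulN1r; under [X in has_mean X _]eq_fun do rewrite /= mulN1r.
Qed.

Lemma has_mean_sum (I : Type) (s : seq I) (f : I -> T -> R) (a : I -> R) :
  (forall i, has_mean (f i) (a i)) ->
  has_mean (fun x => \sum_(i <- s) f i x) (\sum_(i <- s) a i).
Proof.
move=> h; elim: s => [|i s IH].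
  by rewrite big_nil; under [X in has_mean X _]eq_fun do rewrite big_nil; exact: has_mean_cst.
rewrite big_cons; under [X in has_mean X _]eq_fun do rewrite big_cons.
exact: has_meanD.
Qed.

Lemma has_mean_le f g b : measurable_fun [set: T] f -> (forall x, `|f x| <= g x) ->
  has_mean g b -> exists a, has_mean f a.
Proof.
move=> mf fg [gi _].
have fi : P.-integrable [set: T] (EFin \o f).
  apply: (le_integrable measurableT _ _ gi); first exact/measurable_EFinP.
  by move=> x _; rewrite lee_fin (le_trans (fg x))// ler_norm.
exists (fine (\int[P]_x (f x)%:E)); split => //.
by rewrite fineK//; exact: integrable_fin_num.
Qed.

Lemma has_mean_inj f a b : has_mean f a -> has_mean f b -> a = b.
Proof. by move=> [_ fE] [_]; rewrite fE => -[]. Qed.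

Lemma has_mean_ge0 f a : has_mean f a -> (forall x, 0 <= f x) -> 0 <= a.
Proof.
by move=> [_ fE] f0; rewrite -lee_fin -fE; apply: integral_ge0 => x _; rewrite lee_fin.
Qed.

Lemma markov_inequality f (a t : R) : has_mean f a -> (forall x, 0 <= f x) -> 0 < t ->
  (P [set x | (t <= f x)%R] <= (a / t)%:E)%E.
Proof.
move=> hf f0 t0; have mf := has_mean_measurable hf; have [_ fE] := hf.
have mE : measurable [set x | t <= f x].
  rewrite [X in measurable X](_ : _ = f @^-1` `[t, +oo[%classic).
    by rewrite -[X in measurable X]setTI; apply: mf.
  by apply/seteqP; split => x /=; rewrite in_itv /= andbT.
rewrite -(@lee_pmul2l _ t%:E)// -?EFinM mulrC mulfVK ?gt_eqF// -fE -integral_cst//.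
rewrite (@integral_mkcond _ _ _ _ _ (cst t%:E)).
apply: ge0_le_integral => //.
- by move=> x _; rewrite patchE; case: ifP => //; rewrite lee_fin ltW.
- by apply: (measurable_restrictT _ _).1.
- exact/measurable_EFinP.
- move=> x _; rewrite patchE; case: ifPn => h; rewrite lee_fin//.
  by move: h; rewrite inE.
Qed.

End HasMean.

Lemma has_mean_image d1 d2 (T1 : measurableType d1) (T2 : measurableType d2)
    (R : realType) (P1 : probability T1 R) (P2 : probability T2 R) (phi : T2 -> T1) :
  measurable_fun [set: T2] phi ->
  (forall B, measurable B -> P1 B = P2 (phi @^-1` B)) ->
  forall f a, has_mean P1 f a -> has_mean P2 (f \o phi) a.
Proof.
move=> mphi h f a [/integrableP[mf fi] fE]; split.
  apply/integrableP; split; first exact: (measurableT_comp mf).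
  have mabs : measurable_fun [set: T1] (fun x => `|(f x)%:E|)%E.
    exact: (measurableT_comp _ mf).
  by rewrite -(ge0_integral_image mphi h mabs).
rewrite -fE integralE [RHS]integralE; congr (_ - _)%E.
  apply/esym; have -> : ((fun x => ((f \o phi) x)%:E)^\+)%E = (EFin \o f)^\+%E \o phi.
    by apply/funext => x; rewrite /= !funeposE.
  by apply: (ge0_integral_image mphi h) => //; exact: measurable_funepos.
apply/esym; have -> : ((fun x => ((f \o phi) x)%:E)^\-)%E = (EFin \o f)^\-%E \o phi.
  by apply/funext => x; rewrite /= !funenegE.
by apply: (ge0_integral_image mphi h) => //; exact: measurable_funeneg.
Qed.

Lemma has_mean_mul d1 d2 (T1 : measurableType d1) (T2 : measurableType d2)
    (R : realType) (P : probability T1 R) (Q : probability T2 R) f g a b :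
  has_mean P f a -> has_mean Q g b ->
  has_mean (P \x Q)%E (fun xy => f xy.1 * g xy.2) (a * b).
Proof.
move=> hf hg; have mf := has_mean_measurable hf; have mg := has_mean_measurable hg.
have [/integrableP[_ fi] fE] := hf; have [/integrableP[_ gi] gE] := hg.
have mfg : measurable_fun [set: T1 * T2] (EFin \o (fun xy => f xy.1 * g xy.2)).
  apply/measurable_EFinP; apply: measurable_funM.
    exact: (measurableT_comp mf).
  exact: (measurableT_comp mg).
have maf : measurable_fun setT (fun x => `|(f x)%:E|%E).
  by apply: measurableT_comp => //; exact/measurable_EFinP.
have mag : measurable_fun setT (fun x => `|(g x)%:E|%E).
  by apply: measurableT_comp => //; exact/measurable_EFinP.
have ifg : (P \x Q)%E.-integrable [set: T1 * T2] (EFin \o (fun xy => f xy.1 * g xy.2)).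
  apply/(integrable12ltyP _ _ mfg).
  rewrite [ltLHS](_ : _ = (\int[P]_x `|(f x)%:E| * \int[Q]_y `|(g y)%:E|)%E).
    by rewrite lte_mul_pinfty// ?integral_ge0// ge0_fin_numE// integral_ge0.
  rewrite -ge0_integralZr//; last by apply: integral_ge0.
  apply: eq_integral => x _; rewrite -ge0_integralZl//.
  by apply: eq_integral => y _; rewrite /= normrM.
split => //; rewrite -(integral12_prod_meas1 ifg) /fubini_F /=.
transitivity (\int[P]_x ((f x)%:E * b%:E))%E.
  apply: eq_integral => x _; rewrite -gE; under eq_integral do rewrite EFinM.
  by rewrite integralZl//; case: hg.
have [_ h] := has_meanZ b hf; rewrite [a * b]mulrC -h.
by apply: eq_integral => x _; rewrite -EFinM mulrC.
Qed.

Lemma has_mean_image_inv d1 d2 (T1 : measurableType d1) (T2 : measurableType d2)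
    (R : realType) (P1 : probability T1 R) (P2 : probability T2 R) (phi : T2 -> T1) :
  measurable_fun [set: T2] phi ->
  (forall B, measurable B -> P1 B = P2 (phi @^-1` B)) ->
  forall f a, measurable_fun [set: T1] f -> has_mean P2 (f \o phi) a -> has_mean P1 f a.
Proof.
move=> mphi h f a mf hf.
have mEf : measurable_fun [set: T1] (EFin \o f) by exact/measurable_EFinP.
have fi : P1.-integrable [set: T1] (EFin \o f).
  apply/integrableP; split => //.
  have mabs : measurable_fun [set: T1] (fun x => `|(f x)%:E|)%E.
    exact: (measurableT_comp _ mEf).
  rewrite (ge0_integral_image mphi h mabs)//.
  by have [/integrableP[]] := hf.
have h1 : has_mean P1 f (fine (\int[P1]_x (f x)%:E)).
  by split => //; rewrite fineK//; exact: integrable_fin_num.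
by have := has_mean_inj (has_mean_image mphi h h1) hf => <-.
Qed.

Section IidSums.
Context d (T : measurableType d) (R : realType) (P : probability T R).

Lemma iid_tnth n (i : 'I_n) (B : set T) : measurable B ->
  P B = iid P n ((fun z => tnth z i) @^-1` B).
Proof.
move=> mB; pose A (l : 'I_n) := if l == i then B else setT.
rewrite (_ : _ @^-1` B = [set x | forall l, A l (tnth x l)]); last first.
  apply/seteqP; split => x /=; rewrite /A; first by move=> xB l; case: eqP => // ->.
  by move=> /(_ i); rewrite eqxx.
rewrite iid_box => [|l]; last by rewrite /A; case: ifP.
rewrite (bigD1 i)//= {1}/A eqxx big1 ?mule1// => l /negbTE li.
by rewrite /A li; exact: probability_setT.
Qed.

Lemma has_mean_tnth n (i : 'I_n) f a : has_mean P f a ->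
  has_mean (iid P n) (fun z => f (tnth z i)) a.
Proof.
by apply: (has_mean_image (@measurable_tnth _ T n i)) => B mB; exact: iid_tnth.
Qed.

Lemma has_mean_iid_cons n (F : n.+1.-tuple T -> R) a : measurable_fun [set: n.+1.-tuple T] F ->
  has_mean (P \x iid P n)%E (fun xz => F (iid_cons xz)) a -> has_mean (iid P n.+1) F a.
Proof. by apply: has_mean_image_inv => //; exact: measurable_iid_cons. Qed.

(** Independent centred terms: splitting off the first sample, the cross term has
mean 0 * 0. *)
Lemma has_mean_sum_sqr n (h : 'I_n -> T -> R) (v : 'I_n -> R) :
  (forall i, has_mean P (h i) 0) -> (forall i, has_mean P (fun x => h i x ^+ 2) (v i)) ->
  has_mean (iid P n) (fun z => (\sum_i h i (tnth z i)) ^+ 2) (\sum_i v i).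
Proof.
elim: n h v => [|n IH] h v h0 hv.
  rewrite big_ord0; under [X in has_mean _ X _]eq_fun do rewrite big_ord0 expr0n.
  exact: has_mean_cst.
apply: has_mean_iid_cons.
  apply: measurable_funX; apply: measurable_sum => i.
  exact: (measurableT_comp (has_mean_measurable (h0 i)) (measurable_tnth i)).
rewrite big_ord_recl.
pose S z := \sum_i h (lift ord0 i) (tnth z i).
under [X in has_mean _ X _]eq_fun => xz.
  have -> : \sum_i h i (tnth (iid_cons xz) i) = h ord0 xz.1 + S xz.2.
    by rewrite big_ord_recl tnth0; congr (_ + _); apply: eq_bigr => i _; rewrite tnthS.
  rewrite sqrrD -(mulr1 (h ord0 xz.1 ^+ 2)) -(mul1r (S xz.2 ^+ 2)) -mulr_natl.
  over.
have hS : has_mean (iid P n) S 0.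
  have := has_mean_sum (index_enum _) (fun i => has_mean_tnth i (h0 (lift ord0 i))).
  by rewrite big1.
have hS2 : has_mean (iid P n) (fun z => S z ^+ 2) (\sum_i v (lift ord0 i)).
  exact: (IH (fun i => h (lift ord0 i)) (fun i => v (lift ord0 i))).
rewrite -[v ord0]mulr1 -[\sum_i _]mul1r -[v ord0 * 1]addr0 -[X in _ + X + _](mulr0 2).
apply: has_meanD; last exact: has_mean_mul (has_mean_cst P 1) hS2.
apply: has_meanD.
  exact: has_mean_mul (hv ord0) (has_mean_cst (iid P n) 1).
by apply: has_meanZ; rewrite -(mulr0 0); exact: has_mean_mul (h0 ord0) hS.
Qed.

Definition average n (g : T -> R) (x : n.-tuple T) : R :=
  n%:R^-1 * \sum_(i < n) g (tnth x i).

Lemma measurable_average n g : measurable_fun [set: T] g ->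
  measurable_fun [set: n.-tuple T] (@average n g).
Proof.
move=> mg; apply: measurable_funM => //; apply: measurable_sum => i.
exact: (measurableT_comp mg (measurable_tnth i)).
Qed.

(** The inequality of Chebyshev. *)
Lemma weak_law n g (v e : R) : has_mean P g 0 -> has_mean P (fun x => g x ^+ 2) v -> 0 < e ->
  (0 < n)%N ->
  (iid P n [set x | (e <= `|average g x|)%R] <= (v / (n%:R * e ^+ 2))%:E)%E.
Proof.
move=> g0 gv e0 n0.
have n0' : 0 < n%:R :> R by rewrite ltr0n.
have t0 : 0 < (n%:R * e) ^+ 2 by rewrite exprn_gt0// mulr_gt0.
have := markov_inequality (@has_mean_sum_sqr n (fun=> g) (fun=> v) (fun=> g0) (fun=> gv)) _ t0.
move=> /(_ (fun=> sqr_ge0 _)).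
rewrite sumr_const card_ord.
have -> : v *+ n / (n%:R * e) ^+ 2 = v / (n%:R * e ^+ 2).
  by rewrite -mulr_natr; field; rewrite !gt_eqF.
congr (iid P n _ <= _)%E; apply/funext => x /=; congr is_true.
rewrite /average normrM [X in _ = (_ <= X * _)]ger0_norm ?invr_ge0 ?ler0n//.
rewrite ler_pdivlMl// -[X in _ <= X]real_normK ?num_real//.
by rewrite ler_sqr ?nnegrE// mulr_ge0 ?ler0n ?ltW.
Qed.
End IidSums.

(** * Standardised normal coordinates *)

Section NormalMoments.
Variable R : realType.
Notation N := (@normal_prob R 0 1).

Lemma has_mean_expR c : has_mean N (fun x => expR (c * x)) (expR (c ^+ 2 / 2)).
Proof.
have := normal_translate c (measurable_cst 1%E) (fun=> lee01).
rewrite integral_cst// mul1e; under [X in _ = X -> _]eq_integral do rewrite mul1e.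
rewrite /= => h.
have mE : measurable_fun [set: R] (fun x => expR (c * x)).
  by apply: measurableT_comp => //; exact: measurable_expR.
have mE' : measurable_fun [set: R] (fun x => (expR (c * x - c ^+ 2 / 2))%:E).
  by apply/measurable_EFinP; apply: measurableT_comp => //; exact: measurable_funB.
have E : (\int[N]_x (expR (c * x))%:E)%E = (expR (c ^+ 2 / 2))%:E.
  transitivity (\int[N]_x ((expR (c ^+ 2 / 2))%:E * (expR (c * x - c ^+ 2 / 2))%:E))%E.
    by apply: eq_integral => x _; rewrite -EFinM -expRD addrC subrK.
  rewrite ge0_integralZl//.
  - by rewrite -h; rewrite -[RHS]mule1; congr (_ * _)%E; exact: probability_setT.
split => //; apply/integrableP; split; first exact/measurable_EFinP.
under eq_integral do rewrite /= ger0_norm ?expR_ge0//.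
by rewrite E ltry.
Qed.

(** From exp (y / 4) >= y / 4.  Fourth moments of the normal law are obtained by
domination by its exponential moments. *)
Lemma pow4_le_expR (x : R) : x ^+ 4 <= 256 * (expR (1 * x) + expR (-1 * x)).
Proof.
have key (y : R) : 0 <= y -> y ^+ 4 <= 256 * expR y.
  move=> y0; have h : y / 4 <= expR (y / 4) by apply: le_trans (expR_ge1Dx _); lra.
  have -> : expR y = expR (y / 4) ^+ 4.
    by rewrite -expRM_natl; congr expR; field.
  have -> : y ^+ 4 = 256 * (y / 4) ^+ 4 by field.
  by rewrite ler_pM2l// lerXn2r ?nnegrE ?expR_ge0// divr_ge0.
rewrite mul1r mulN1r; have [x0|x0] := leP 0 x.
  by apply: le_trans (key _ x0) _; rewrite ler_pM2l// lerDl expR_ge0.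
have -> : x ^+ 4 = (- x) ^+ 4 by ring.
apply: le_trans (key (- x) _) _; first by rewrite oppr_ge0 ltW.
by rewrite ler_pM2l// lerDr expR_ge0.
Qed.

Lemma has_mean_pow4 : exists k, has_mean N (fun x => x ^+ 4) k.
Proof.
apply: (@has_mean_le _ (measurableTypeR R) R N (fun x : R => x ^+ 4)
  (fun x : R => 256 * (expR (1 * x) + expR (-1 * x))) _).
- exact: measurable_funX.
- by move=> x; rewrite ger0_norm ?pow4_le_expR// exprn_even_ge0.
- by apply: has_meanZ; apply: has_meanD; exact: has_mean_expR.
Qed.

Lemma pow4_subr_le (x m : R) : (x - m) ^+ 4 <= 8 * (x ^+ 4 + m ^+ 4).
Proof.
have sq (a b : R) : (a - b) ^+ 2 <= 2 * (a ^+ 2 + b ^+ 2).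
  by rewrite -subr_ge0 (_ : _ - _ = (a + b) ^+ 2) ?sqr_ge0//; ring.
have h1 := sq x m; have h2 := sq (x ^+ 2) (- m ^+ 2).
have -> : (x - m) ^+ 4 = ((x - m) ^+ 2) ^+ 2 by ring.
apply: (@le_trans _ _ ((2 * (x ^+ 2 + m ^+ 2)) ^+ 2)).
  by rewrite lerXn2r ?nnegrE ?sqr_ge0// mulr_ge0// addr_ge0 ?sqr_ge0.
rewrite opprK sqrrN in h2; rewrite exprMn.
have -> : 8 * (x ^+ 4 + m ^+ 4) = 2 ^+ 2 * (2 * ((x ^+ 2) ^+ 2 + (m ^+ 2) ^+ 2)) by ring.
by rewrite ler_wpM2l// sqr_ge0.
Qed.

Lemma sqr_le_pow4 (x : R) : x ^+ 2 <= 1 + x ^+ 4.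
Proof.
rewrite -subr_ge0 (_ : _ - _ = (x ^+ 2 - 2^-1) ^+ 2 + 3 / 4); last by field.
by rewrite addr_ge0 ?sqr_ge0// divr_ge0.
Qed.

Lemma norm_le_pow4 (x : R) : `|x| <= 1 + (1 + x ^+ 4).
Proof.
apply: (@le_trans _ _ (1 + x ^+ 2)); last by rewrite lerD2l sqr_le_pow4.
rewrite -subr_ge0 -(real_normK (num_real x)).
rewrite (_ : _ - _ = (`|x| - 2^-1) ^+ 2 + 3 / 4); last by field.
by rewrite addr_ge0 ?sqr_ge0// divr_ge0.
Qed.

Lemma has_mean_id : exists m, has_mean N id m.
Proof.
have [k hk] := has_mean_pow4.
apply: (@has_mean_le _ (measurableTypeR R) R N id (fun x : R => 1 + (1 + x ^+ 4)) (1 + (1 + k))) => //.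
  exact: norm_le_pow4.
exact: has_meanD (has_mean_cst N 1) (has_meanD (has_mean_cst N 1) hk).
Qed.

(** A variable of variance zero is almost surely constant, but points are null
sets for the normal law. *)
Lemma normal_variance_gt0 m v : has_mean N (fun x => (x - m) ^+ 2) v -> 0 < v.
Proof.
move=> hv; rewrite lt_def (has_mean_ge0 hv) ?andbT => [|x]; last exact: sqr_ge0.
apply/eqP => v0; have [_ ] := hv; rewrite v0 => iE.
have mf : measurable_fun [set: measurableTypeR R] (fun x : R => ((x - m) ^+ 2)%:E).
  by apply/measurable_EFinP; exact: has_mean_measurable hv.
have ae : ae_eq N setT (fun x : R => ((x - m) ^+ 2)%:E) (cst 0%E).
  apply/(ae_eq_integral_abs _ measurableT mf); rewrite -[RHS]iE.
  by apply: eq_integral => x _; rewrite /= ger0_norm ?sqr_ge0.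
have [Z [mZ Z0 sub]] := ae.
have Nm : N [set m] = 0%E.
  have /null_content_dominatesP := normal_prob_dominates (0 : R) (1 : R).
  by apply => //; exact: lebesgue_measure_set1.
have : (N setT <= N ([set m] `|` Z))%E.
  apply: le_measure; rewrite ?inE//; first exact: measurableU.
  move=> x _; have [->|xm] := eqVneq x m; [by left|right; apply: sub].
  by move=> /= /(_ Logic.I) [] /eqP; rewrite sqrf_eq0 subr_eq0 (negbTE xm).
move=> h; have N0 : (N setT <= 0)%E.
  by apply: (le_trans h); rewrite measureU0// -[leRHS]Nm.
have N1 : N setT = 1%E by exact: probability_setT.
by move: N0; rewrite N1 lee_fin ler10.
Qed.

(** Centring and scaling by the mean m and the standard deviation s, whatever they
are, avoids computing the first two moments of the normal law: an affine change
of Z only changes mu and A in the representation of a Gaussian vector. *)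
Lemma standardize : exists m s : R, [/\ 0 < s,
  has_mean N (fun x => (x - m) / s) 0, has_mean N (fun x => ((x - m) / s) ^+ 2) 1 &
  exists k, has_mean N (fun x => ((x - m) / s) ^+ 4) k].
Proof.
have [k hk] := has_mean_pow4; have [m hm] := has_mean_id.
have hc : has_mean N (fun x => x - m) 0.
  by have := has_meanB hm (has_mean_cst N m); rewrite subrr.
have bound4 := fun x => pow4_subr_le x m.
have mxm : measurable_fun [set: measurableTypeR R] (fun x : R => x - m).
  exact: has_mean_measurable hc.
have hg : has_mean N (fun x : R => 8 * (x ^+ 4 + m ^+ 4)) (8 * (k + m ^+ 4)).
  exact: has_meanZ (has_meanD hk (has_mean_cst N (m ^+ 4))).
have [k4 hk4] : exists k, has_mean N (fun x : R => (x - m) ^+ 4) k.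
  apply: (@has_mean_le _ (measurableTypeR R) R N _ (fun x : R => 8 * (x ^+ 4 + m ^+ 4)) _) => //.
  - exact: measurable_funX.
  - by move=> x; rewrite ger0_norm ?bound4// exprn_even_ge0.
  - exact: hg.
have [v hv] : exists v, has_mean N (fun x : R => (x - m) ^+ 2) v.
  apply: (@has_mean_le _ (measurableTypeR R) R N _ (fun x : R => 1 + (x - m) ^+ 4) (1 + k4)) => //.
  - exact: measurable_funX.
  - move=> x; rewrite ger0_norm ?sqr_ge0//; exact: sqr_le_pow4.
  - exact: has_meanD (has_mean_cst N 1) hk4.
have v0 := normal_variance_gt0 hv.
have s0 : 0 < Num.sqrt v by rewrite sqrtr_gt0.
exists m, (Num.sqrt v); split => //.
- under [X in has_mean _ X _]eq_fun do rewrite mulrC.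
  by have := has_meanZ (Num.sqrt v)^-1 hc; rewrite mulr0.
- under [X in has_mean _ X _]eq_fun do rewrite exprMn exprVn sqr_sqrtr ?(ltW v0)// mulrC.
  by have := has_meanZ v^-1 hv; rewrite mulVf ?gt_eqF.
- exists ((Num.sqrt v)^-1 ^+ 4 * k4).
  under [X in has_mean _ X _]eq_fun do rewrite exprMn mulrC.
  exact: has_meanZ hk4.
Qed.
End NormalMoments.

Section ResidualScale.
Variables (R : rcfType) (p m : nat) (B : 'M[R]_(m, p)).
Lemma residualZ c (v : 'rV[R]_p) : row_free B -> c != 0 ->
  residual (c *: B) (c *: v) = c *: residual B v.
Proof.
move=> Bf c0; rewrite /residual /regression scalerBr; congr (_ - _).
have -> : (c *: B)^T = c *: B^T by apply/matrixP => i j; rewrite !mxE.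
have -> : c *: B *m (c *: B^T) = (c * c) *: (B *m B^T).
  by rewrite -scalemxAl -scalemxAr scalerA.
have cc : c * c \is a GRing.unit by rewrite unitfE mulf_neq0.
rewrite invmxZ; last by rewrite unitmxZ// unitmx_gram1.
rewrite -!(scalemxAl, scalemxAr) !scalerA; congr (_ *: _).
by field.
Qed.
End ResidualScale.

Section StandardCoordinates.
Variables (R : realType) (p : nat).
Notation RV := (p.-tuple R).
Notation N := (@normal_prob R 0 1).
Notation gauss := (iid N p).
Variables (m s : R).
Notation h := (fun x : R => (x - m) / s).
Hypothesis s0 : 0 < s.
Hypothesis h1 : has_mean N h 0.
Hypothesis h2 : has_mean N (fun x => h x ^+ 2) 1.
Variable k4 : R.
Hypothesis h4 : has_mean N (fun x => h x ^+ 4) k4.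

Lemma gauss_mean a : has_mean gauss (fun z => h (tnth z a)) 0.
Proof. exact: (has_mean_tnth a h1). Qed.

(** For distinct coordinates, by polarisation of [has_mean_sum_sqr] applied to
the sum of these two coordinates only. *)
Lemma gauss_product a b :
  has_mean gauss (fun z => h (tnth z a) * h (tnth z b)) (a == b)%:R.
Proof.
have sq c : has_mean gauss (fun z => h (tnth z c) ^+ 2) 1.
  exact: (has_mean_tnth c h2).
have [->|ab] := eqVneq a b; first exact: sq.
pose u (i : 'I_p) : R := (i == a)%:R + (i == b)%:R.
have hu i : has_mean N (fun x => u i * h x) 0.
  by have := has_meanZ (u i) h1; rewrite mulr0.
have hu2 i : has_mean N (fun x => (u i * h x) ^+ 2) (u i ^+ 2).
  under [X in has_mean _ X _]eq_fun do rewrite exprMn.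
  by have := has_meanZ (u i ^+ 2) h2; rewrite mulr1.
have := has_meanZ 2^-1 (has_meanB (has_meanB (has_mean_sum_sqr hu hu2) (sq a)) (sq b)).
have two (f : 'I_p -> R) : \sum_i u i * f i = f a + f b.
  under eq_bigr do rewrite /u mulrDl; rewrite big_split /=; congr (_ + _).
    rewrite (bigD1 a)//= eqxx mul1r big1 ?addr0// => i /negbTE->; exact: mul0r.
  rewrite (bigD1 b)//= eqxx mul1r big1 ?addr0// => i /negbTE->; exact: mul0r.
have -> : \sum_i u i ^+ 2 = 2.
  under eq_bigr do rewrite expr2; by rewrite two /u !eqxx [b == a]eq_sym (negbTE ab) addr0 add0r.
rewrite (_ : 2^-1 * _ = false%:R); last by rewrite -addrA -opprD subrr mulr0.
set F := (X in has_mean _ X _); set F' := (X in _ -> has_mean _ X _).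
suff -> : F = F' by [].
apply/funext => z; rewrite /F /F' (two (fun i => h (tnth z i))).
set x := h _; set y := h _; by clear; field.
Qed.

Lemma gauss_product_sqr a b : exists v,
  has_mean gauss (fun z => (h (tnth z a) * h (tnth z b) - (a == b)%:R) ^+ 2) v.
Proof.
have m1 c : measurable_fun [set: p.-tuple (measurableTypeR R)] (fun z => h (tnth z c)).
  exact: has_mean_measurable (gauss_mean c).
apply: (@has_mean_le _ _ _ gauss _
  (fun z => (h (tnth z a) ^+ 4 + h (tnth z b) ^+ 4) + 2) (k4 + k4 + 2)).
- by apply: measurable_funX; apply: measurable_funB => //; exact: measurable_funM.
- move=> z; rewrite ger0_norm ?sqr_ge0//.
  set x := h _; set y := h _; set d : R := (_ == _)%:R.
  have d1 : d ^+ 2 <= 1 by rewrite /d; case: (a == b); rewrite ?expr1n ?expr0n.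
  rewrite -subr_ge0.
  have -> : x ^+ 4 + y ^+ 4 + 2 - (x * y - d) ^+ 2 =
    (x ^+ 2 - y ^+ 2) ^+ 2 + (x * y + d) ^+ 2 + 2 * (1 - d ^+ 2) by clear; ring.
  by rewrite !addr_ge0 ?sqr_ge0// mulr_ge0// subr_ge0.
- exact: has_meanD (has_meanD (has_mean_tnth a h4) (has_mean_tnth b h4)) (has_mean_cst _ 2).
Qed.

Section Law.
Variables (P : probability RV R) (mu : 'cV[R]_p) (A : 'M[R]_p).
Notation aff := (Defs.affine mu A).
Hypothesis uA : A \in unitmx.
Hypothesis PE : forall B : set RV, measurable B -> P B = gauss (aff @^-1` B).

Definition scaled : 'M[R]_p := s *: A.
Definition center (j : 'I_p) : R := mu j 0 + \sum_i A j i * m.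
(** The standardised coordinates, as functions of X. *)
Definition whiten (a : 'I_p) (x : RV) : R :=
  \sum_j invmx scaled a j * (tnth x j - center j).

Lemma scaled_unit : scaled \in unitmx.
Proof. by rewrite unitmxZ// unitfE gt_eqF. Qed.

Lemma affine_standard z j : tnth (aff z) j = center j + \sum_i scaled j i * h (tnth z i).
Proof.
rewrite tnth_affine /center -addrA; congr (_ + _); rewrite /linform -big_split.
apply: eq_bigr => i _ /=; rewrite mxE.
have s0' : s != 0 by rewrite gt_eqF.
by field.
Qed.

Lemma whiten_affine a z : whiten a (aff z) = h (tnth z a).
Proof.
rewrite /whiten; under eq_bigr do rewrite affine_standard addrAC subrr add0r mulr_sumr.
rewrite exchange_big /=.
have VA : invmx scaled *m scaled = 1%:M by rewrite mulVmx// scaled_unit.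
rewrite (eq_bigr (fun i => (a == i)%:R * h (tnth z i))) => [|i _]; last first.
  have /matrixP/(_ a i) := VA; rewrite [LHS]mxE [RHS]mxE => <-.
  by rewrite [RHS]mulr_suml; apply: eq_bigr => j _; exact: mulrA.
rewrite (bigD1 a)//= eqxx mul1r big1 ?addr0// => i /negbTE ia.
by rewrite eq_sym ia mul0r.
Qed.

Lemma unwhiten x j : tnth x j = center j + \sum_a scaled j a * whiten a x.
Proof.
rewrite /whiten; under eq_bigr do rewrite mulr_sumr.
rewrite exchange_big /=.
have AV : scaled *m invmx scaled = 1%:M by rewrite mulmxV// scaled_unit.
rewrite (eq_bigr (fun i => (j == i)%:R * (tnth x i - center i))) => [|i _]; last first.
  have /matrixP/(_ j i) := AV; rewrite [LHS]mxE [RHS]mxE => <-.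
  by rewrite [RHS]mulr_suml; apply: eq_bigr => a _; exact: mulrA.
rewrite (bigD1 j)//= eqxx mul1r big1 ?addr0 => [|i /negbTE ij].
  by rewrite addrC subrK.
by rewrite eq_sym ij mul0r.
Qed.

Lemma measurable_whiten a : measurable_fun [set: RV] (whiten a).
Proof.
apply: measurable_sum => j; apply: measurable_funM => //.
by apply: measurable_funB => //; exact: measurable_tnth.
Qed.

Lemma has_mean_law (f : RV -> R) r : measurable_fun [set: RV] f ->
  has_mean gauss (fun z => f (aff z)) r -> has_mean P f r.
Proof.
exact: (@has_mean_image_inv _ _ RV (p.-tuple (measurableTypeR R)) R P gauss aff
  (measurable_affine mu A) PE f r).
Qed.

Lemma whiten_mean a : has_mean P (whiten a) 0.
Proof.
apply: has_mean_law; first exact: measurable_whiten.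
under [X in has_mean _ X _]eq_fun do rewrite whiten_affine.
exact: gauss_mean.
Qed.

Lemma whiten_product a b : has_mean P (fun x => whiten a x * whiten b x) (a == b)%:R.
Proof.
apply: has_mean_law.
  by apply: measurable_funM; exact: measurable_whiten.
under [X in has_mean _ X _]eq_fun do rewrite !whiten_affine.
exact: gauss_product.
Qed.

(** The value v is read off from the normal law, so it is the same for all P; this
is where the uniformity of the rate comes from. *)
Lemma whiten_product_sqr a b v :
  has_mean gauss (fun z => (h (tnth z a) * h (tnth z b) - (a == b)%:R) ^+ 2) v ->
  has_mean P (fun x => (whiten a x * whiten b x - (a == b)%:R) ^+ 2) v.
Proof.
move=> hv; apply: has_mean_law.
  apply: measurable_funX; apply: measurable_funB => //.
  by apply: measurable_funM; exact: measurable_whiten.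
by under [X in has_mean _ X _]eq_fun do rewrite !whiten_affine.
Qed.

Lemma cov_law : Defs.cov P = scaled *m scaled^T.
Proof.
apply/matrixP => j k; rewrite [LHS]mxE [RHS]mxE.
have hc i : has_mean P (Defs.coord i) (center i).
  have -> : Defs.coord i = (fun x => center i + \sum_a scaled i a * whiten a x).
    by apply/funext => x; rewrite /Defs.coord [LHS]unwhiten.
  have := has_meanD (has_mean_cst P (center i))
    (has_mean_sum (index_enum _) (fun a => has_meanZ (scaled i a) (whiten_mean a))).
  by rewrite big1 ?addr0// => a _; rewrite mulr0.
have Ec i : fine 'E_P[Defs.coord i] = center i.
  by rewrite expectation.unlock; have [_ ->] := hc i.
have : has_mean P (fun x => (Defs.coord j x - center j) * (Defs.coord k x - center k))
    (\sum_a \sum_b scaled j a * scaled k b * (a == b)%:R).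
  have -> : (fun x => (Defs.coord j x - center j) * (Defs.coord k x - center k)) =
     (fun x => \sum_a \sum_b scaled j a * scaled k b * (whiten a x * whiten b x)).
    apply/funext => x; rewrite /Defs.coord !unwhiten ![center _ + _]addrC !addrK.
    rewrite mulr_suml; apply: eq_bigr => a _; rewrite mulr_sumr.
    by apply: eq_bigr => b _; rewrite mulrACA.
  apply: has_mean_sum => a; apply: has_mean_sum => b; apply: has_meanZ.
  exact: whiten_product.
move=> [_ E]; rewrite covariance.unlock !Ec expectation.unlock.
rewrite [X in fine X = _](_ : _ = (\sum_a \sum_b scaled j a * scaled k b * (a == b)%:R)%:E).
  rewrite /=; apply: eq_bigr => a _; rewrite [scaled^T _ _]mxE (bigD1 a)//= eqxx mulr1.
  by rewrite big1 ?addr0// => b ba; rewrite eq_sym (negbTE ba) mulr0.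
by rewrite -E; apply: eq_integral.
Qed.

(** Orthogonality of residuals is unaffected by the common scale s. *)
Lemma cond_indep_partial_cov0 (S : {set 'I_p}) j k :
  cond_indep P j k S -> partial_cov P j k S = 0.
Proof.
move=> ci; rewrite (partial_cov_gram scaled_unit cov_law).
have Bf := rows_free S uA.
have s0' : s != 0 by rewrite gt_eqF.
have rE i : row i scaled = s *: row i A by apply/rowP => a; rewrite !mxE.
have BE : rows scaled S = s *: rows A S by apply/matrixP => a b; rewrite !mxE.
rewrite !rE BE !residualZ// bilform1E.
have := cond_indep_orthogonal uA PE ci; rewrite bilform1E => o.
transitivity (s ^+ 2 * (\sum_i residual (rows A S) (row j A) 0 i * residual (rows A S) (row k A) 0 i)).
  by rewrite mulr_sumr; apply: eq_bigr => i _; rewrite mxE [X in _ * X]mxE mulrACA.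
by rewrite o mulr0.
Qed.

End Law.
End StandardCoordinates.

(** * The sample covariance *)

Section SampleCovariance.
Context d (T : measurableType d) (R : realType) (n : nat).
Hypothesis n_gt0 : (0 < n)%N.
Implicit Types (f g : T -> R) (c e dl : R).

Definition sample_cov f g (x : n.-tuple T) : R :=
  average (fun v => f v * g v) x - average f x * average g x.

Lemma average_cst c (x : n.-tuple T) : average (cst c) x = c.
Proof.
rewrite /average sumr_const card_ord -[c *+ _]mulr_natl mulKf// pnatr_eq0.
by rewrite -lt0n.
Qed.

Lemma averageD f g (x : n.-tuple T) : average (f \+ g) x = average f x + average g x.
Proof. by rewrite /average big_split mulrDr. Qed.

Lemma averageZ c f (x : n.-tuple T) : average (fun v => c * f v) x = c * average f x.
Proof. by rewrite /average -mulr_sumr mulrCA. Qed.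

Lemma average_sum (I : Type) (s : seq I) (f : I -> T -> R) (x : n.-tuple T) :
  average (fun v => \sum_(i <- s) f i v) x = \sum_(i <- s) average (f i) x.
Proof. by rewrite /average exchange_big /= mulr_sumr. Qed.

Lemma sample_cov_affine (p : nat) (Y : 'I_p -> T -> R) (c e : R) (al be : 'I_p -> R) x :
  sample_cov (fun v => c + \sum_a al a * Y a v) (fun v => e + \sum_b be b * Y b v) x =
  \sum_b \sum_a al a * sample_cov (Y a) (Y b) x * be b.
Proof.
have av q (ga : 'I_p -> R) : average (fun v => q + \sum_a ga a * Y a v) x =
    q + \sum_a ga a * average (Y a) x.
  rewrite (averageD (cst q)) average_cst average_sum.
  by congr (_ + _); apply: eq_bigr => a _; rewrite averageZ.
rewrite /sample_cov !av.
have -> : average (fun v => (c + \sum_a al a * Y a v) * (e + \sum_b be b * Y b v)) x =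
    c * e + c * (\sum_b be b * average (Y b) x) + e * (\sum_a al a * average (Y a) x) +
    \sum_b \sum_a al a * be b * average (fun v => Y a v * Y b v) x.
  rewrite (_ : (fun v => _) = (fun v => (c * e + (c * \sum_b be b * Y b v)) +
     (e * \sum_a al a * Y a v)) \+ (fun v => \sum_b \sum_a al a * be b * (Y a v * Y b v))).
    rewrite averageD (averageD (fun v => c * e + _)) (averageD (cst (c * e))) average_cst.
    rewrite !averageZ !average_sum; congr (_ + _ * _ + _ * _ + _).
    - by apply: eq_bigr => b _; rewrite averageZ.
    - by apply: eq_bigr => a _; rewrite averageZ.
    - by apply: eq_bigr => b _; rewrite average_sum; apply: eq_bigr => a _; rewrite averageZ.
  apply/funext => v /=; set s1 := \sum_a _; set s2 := \sum_b _.
  have -> : \sum_b \sum_a al a * be b * (Y a v * Y b v) = s1 * s2.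
    rewrite /s1 mulr_suml exchange_big; apply: eq_bigr => a _; rewrite /s2 mulr_sumr.
    by apply: eq_bigr => b _; rewrite mulrACA.
  by clearbody s1 s2; ring.
have -> : \sum_b \sum_a al a * (average (fun v => Y a v * Y b v) x - average (Y a) x * average (Y b) x) * be b =
   \sum_b \sum_a al a * be b * average (fun v => Y a v * Y b v) x -
   (\sum_a al a * average (Y a) x) * (\sum_b be b * average (Y b) x).
  rewrite mulr_sumr -sumrB; apply: eq_bigr => b _; rewrite mulr_suml -sumrB.
  by apply: eq_bigr => a _; ring.
set s1 := \sum_a _; set s2 := \sum_b be b * _; set s3 := \sum_b _.
by clearbody s1 s2 s3; ring.
Qed.

Lemma sample_covC f g x : sample_cov f g x = sample_cov g f x.
Proof.
rewrite /sample_cov [average g x * _]mulrC; congr (_ - _).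
by rewrite /average; under eq_bigr do rewrite mulrC.
Qed.

(** The product of the averages is at most e^2, hence at most e. *)
Lemma sample_cov_close f g (x : n.-tuple T) dl e : 0 <= e -> e <= 1 ->
  `|average (fun v => f v * g v - dl) x| <= e -> `|average f x| <= e -> `|average g x| <= e ->
  `|sample_cov f g x - dl| <= 2 * e.
Proof.
move=> e0 e1 h hf hg.
have E : average (fun v => f v * g v - dl) x = average (fun v => f v * g v) x - dl.
  by rewrite (averageD (fun v => f v * g v) (cst (- dl))) average_cst.
rewrite /sample_cov addrAC -E; apply: (le_trans (ler_normB _ _)).
rewrite mulrDl !mul1r; apply: lerD => //; rewrite normrM -[leRHS]mulr1.
by apply: ler_pM; [exact: normr_ge0|exact: normr_ge0|exact: hf|exact: (le_trans hg e1)].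
Qed.

Lemma measurable_sample_cov f g : measurable_fun [set: T] f -> measurable_fun [set: T] g ->
  measurable_fun [set: n.-tuple T] (sample_cov f g).
Proof.
move=> mf mg; apply: measurable_funB.
  by apply: measurable_average; exact: measurable_funM.
by apply: measurable_funM; exact: measurable_average.
Qed.

End SampleCovariance.

Section MeasurableMatrix.
Context d (T : measurableType d) (R : realType).

Lemma measurable_det n (M : T -> 'M[R]_n) :
  (forall i j, measurable_fun [set: T] (fun x => M x i j)) ->
  measurable_fun [set: T] (fun x => \det (M x)).
Proof.
move=> mM; rewrite /determinant; apply: measurable_sum => s.
apply: measurable_funM => //.
rewrite (_ : (fun x => _) = (fun x => \prod_(i <- index_enum 'I_n) M x i (s i)))//.
by apply: measurable_prod => i _; exact: mM.
Qed.

Lemma measurable_adj n (M : T -> 'M[R]_n) i j :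
  (forall i j, measurable_fun [set: T] (fun x => M x i j)) ->
  measurable_fun [set: T] (fun x => (\adj (M x)) i j).
Proof.
move=> mM; under eq_fun do rewrite mxE /cofactor.
apply: measurable_funM => //; apply: measurable_det => a b.
by under eq_fun do rewrite !mxE; exact: mM.
Qed.

Lemma measurable_mulmx m n q (M : T -> 'M[R]_(m, n)) (M' : T -> 'M[R]_(n, q)) i j :
  (forall i j, measurable_fun [set: T] (fun x => M x i j)) ->
  (forall i j, measurable_fun [set: T] (fun x => M' x i j)) ->
  measurable_fun [set: T] (fun x => (M x *m M' x) i j).
Proof.
move=> mM mM'; under eq_fun do rewrite mxE.
by apply: measurable_sum => k; apply: measurable_funM.
Qed.

Lemma measurable_accepts p (l : R) (M : T -> 'M[R]_p) j k (S : {set 'I_p}) :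
  (forall i j, measurable_fun [set: T] (fun x => M x i j)) ->
  measurable_fun [set: T] (fun x => accepts l (M x) j k S).
Proof.
move=> mM.
have ms : forall j k, measurable_fun [set: T] (fun x => scaled_partial_cov (M x) j k S).
  move=> {}j {}k; apply: measurable_funB.
    apply: measurable_funM => //; apply: measurable_det => a b.
    by under eq_fun do rewrite mxE; exact: mM.
  apply: measurable_mulmx => [a b|a b]; last by under eq_fun do rewrite mxE; exact: mM.
  apply: measurable_mulmx => [c e|c e]; first by under eq_fun do rewrite mxE; exact: mM.
  by apply: measurable_adj => f g; under eq_fun do rewrite mxE; exact: mM.
apply: measurable_fun_ler; first by apply: measurable_funM => //; exact: measurable_funX.
by apply: measurable_funM => //; exact: measurable_funM.
Qed.

(** Everything computed from the accepted triples is a function of finitely many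
bits, so measurability of the graph estimate and of the event of failure needs
no analysis of the combinatorial algorithms. *)
Lemma measurable_finite_bits (I : finType) (b : T -> {ffun I -> bool}) (Q : set {ffun I -> bool}) :
  (forall i, measurable_fun [set: T] (fun x => b x i)) -> measurable (b @^-1` Q).
Proof.
move=> mb.
have -> : b @^-1` Q = \bigcup_(f in Q) \bigcap_(i in [set: I]) [set x | b x i = f i].
  apply/seteqP; split => x /=.
    by move=> Qx; exists (b x).
  move=> [f Qf h]; rewrite (_ : b x = f)//; apply/ffunP => i; exact: (h i).
apply: fin_bigcup_measurable; first exact: finite_finset.
move=> f _; apply: fin_bigcap_measurable; first exact: finite_finset.
move=> i _; rewrite -[X in measurable X]setTI.
by have := mb i measurableT [set f i] Logic.I; rewrite /preimage /=.
Qed.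

End MeasurableMatrix.

(** * Tests by graph estimation, and their uniform consistency *)

Section Estimator.
Variable p : nat.
Implicit Types (b : {ffun 'I_p * 'I_p * {set 'I_p} -> bool}) (G : digraph p).

Definition candidate b G : bool :=
  dag G && `[< markov_wrt G (fun j k S => b (j, k, S)) >].

(** The empty graph is only a default value: on the good event the true graph is
a candidate. *)
Definition estimate b : digraph p :=
  if [pick G | candidate b G] is Some G0
  then [arg min_(G < G0 | candidate b G) #|G|] else finset.set0.

Lemma estimateP b G : candidate b G ->
  candidate b (estimate b) /\ (#|estimate b| <= #|G|)%N.
Proof.
move=> bG; rewrite /estimate; case: pickP => [G0 bG0|/(_ G)]; last by rewrite bG.
by case: arg_minnP => // H bH minH; split => //; exact: minH.
Qed.

End Estimator.

Section Test.
Variables (R : realType) (p : nat) (lambda : R).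
Notation RV := (p.-tuple R).

Definition sample_cov_mx n (x : n.-tuple RV) : 'M[R]_p :=
  \matrix_(j, k) sample_cov (Defs.coord j) (Defs.coord k) x.

Definition inferred n (x : n.-tuple RV) : {ffun 'I_p * 'I_p * {set 'I_p} -> bool} :=
  [ffun t => accepts lambda (sample_cov_mx x) t.1.1 t.1.2 t.2].

Definition graph_test n : ci_tests R p n :=
  fun j k S x => dconnectedb (estimate (inferred x)) j k S.

#[local] Arguments graph_test n : clear implicits.

Lemma measurable_inferred n (Q : set {ffun 'I_p * 'I_p * {set 'I_p} -> bool}) :
  measurable ((@inferred n) @^-1` Q).
Proof.
apply: measurable_finite_bits => -[[j k] S]; under eq_fun do rewrite ffunE /=.
apply: measurable_accepts => a b; under eq_fun do rewrite mxE.
by apply: measurable_sample_cov; exact: measurable_coord.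
Qed.

Lemma graph_test_valid n : valid_ci_tests (graph_test n).
Proof.
move=> j k S _; split.
  by apply/funext => x; exact: dconnectedb_sym.
move=> _ Y _; rewrite setTI.
exact: (@measurable_inferred n (fun b => Y (dconnectedb (estimate b) j k S))).
Qed.

Lemma measurable_sp_failure n G : measurable (sp_failure (graph_test n) G).
Proof.
exact: (@measurable_inferred n (fun b => exists2 H,
  sp_output (fun j k S => dconnectedb (estimate b) j k S) H & ~ mec G H)).
Qed.

(** The deterministic part of the theorem: what happens on the good event. *)
Lemma no_sp_failure n (x : n.-tuple RV) (P : probability RV R) (Gs : digraph p) :
  dag Gs -> strong_SMR lambda P Gs ->
  (forall j k S, ci_triple j k S -> dsep Gs j k S -> inferred x (j, k, S)) ->
  (forall j k S, ci_triple j k S -> inferred x (j, k, S) -> `|partial_corr P j k S| <= lambda) ->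
  ~ sp_failure (graph_test n) Gs x.
Proof.
move=> dG smr acc rej [H outH nH].
have cG : candidate (inferred x) Gs by rewrite /candidate dG; apply/asboolP.
have [/andP[dE /asboolP mE] le] := estimateP cG.
apply: nH; apply: (sp_output_mec smr dE _ le outH) => j k S ci sepE.
by split => //; apply: rej ci (mE _ _ _ ci sepE).
Qed.

End Test.
Arguments graph_test {R p} lambda n.

Lemma measure_bigsetU_le d (T : measurableType d) (R : realType)
    (mu : {measure set T -> \bar R}) (I : Type) (s : seq I) (E : I -> set T) :
  (forall i, measurable (E i)) ->
  (mu (\big[setU/set0]_(i <- s) E i) <= \sum_(i <- s) mu (E i))%E.
Proof.
move=> mE; elim: s => [|i s IH]; first by rewrite !big_nil measure0.
rewrite !big_cons; apply: le_trans (measureU2 _ _ _) _ => //.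
  by apply: bigsetU_measurable => k _.
exact: leeD2l.
Qed.

Section Consistency.
Variables (R : realType) (p : nat) (lambda : R).
Hypotheses (p_gt0 : (0 < p)%N) (lambda_gt0 : 0 < lambda).
Notation RV := (p.-tuple R).

(** Failure requires one of the finitely many averages of whitened coordinates and
of their centred products to be off by e.  Each such event has probability at
most a constant over n by [weak_law], and the constants are moments of the
standard normal law. *)
Lemma uniform_failure_bound : exists2 K : R, 0 <= K &
  forall n GP, (0 < n)%N -> SMR_class p lambda GP ->
  (iid GP.2 n (sp_failure (graph_test lambda n) GP.1) <= (K / n%:R)%:E)%E.
Proof.
have [m [s [s0 h1 h2 [k4 h4]]]] := @standardize R.
pose h (x : R) := (x - m) / s.
have /(_ _)/cid vE ab := gauss_product_sqr h1 h4 (p := p) ab.1 ab.2.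
pose v ab := projT1 (vE ab).
have v0 ab : 0 <= v ab by apply: has_mean_ge0 (projT2 (vE ab)) _ => z; exact: sqr_ge0.
(* entries of W within 2 e of the identity, by [sample_cov_close]; then
   [bilform_close] loses a factor p^2 to reach the bound of [accepts_correct] *)
pose e := lambda / (2 * (1 + lambda)) / (2 * (p ^ 2)%:R).
have l1 : 0 < 1 + lambda by rewrite addr_gt0.
have p2 : 1 <= (p ^ 2)%:R :> R by rewrite ler1n expn_gt0 p_gt0.
have p2' : 0 < (p ^ 2)%:R :> R by apply: lt_le_trans p2.
have e0 : 0 < e by rewrite !divr_gt0 ?mulr_gt0.
have e1 : e <= 1.
  rewrite /e ler_pdivrMr ?mulr_gt0// mul1r.
  apply: (@le_trans _ _ 1); last by apply: le_trans p2 _; rewrite ler_peMl ?ler1n// ltW.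
  by rewrite ler_pdivrMr ?mulr_gt0// mul1r; lra.
exists ((\sum_ab v ab + \sum_(a < p) 1) / e ^+ 2).
  by rewrite divr_ge0 ?sqr_ge0// addr_ge0 ?sumr_ge0.
move=> n [Gs P] n0 /= [dG [mu [A uA PE]] mk smr]; rewrite /= in dG PE mk smr *.
pose Y := whiten m s mu A.
pose E1 (ab : 'I_p * 'I_p) := [set x : n.-tuple RV |
  e <= `|average (fun v => Y ab.1 v * Y ab.2 v - (ab.1 == ab.2)%:R) x|].
pose E2 (a : 'I_p) := [set x : n.-tuple RV | e <= `|average (Y a) x|].
have mY a : measurable_fun [set: RV] (Y a) by exact: measurable_whiten.
have mE (f : RV -> R) : measurable_fun [set: RV] f ->
    measurable [set x : n.-tuple RV | e <= `|average f x|].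
  move=> mf; rewrite -[X in measurable X]setTI; apply: measurable_fun_le => //.
  by apply: measurableT_comp => //; exact: measurable_average.
have mE1 ab : measurable (E1 ab).
  by apply: mE; apply: measurable_funB => //; exact: measurable_funM.
have mE2 a : measurable (E2 a) by exact: mE.
pose Bad := \big[setU/set0]_(ab <- index_enum ('I_p * 'I_p)%type) E1 ab `|`
  \big[setU/set0]_(a <- index_enum 'I_p) E2 a.
have mB1 : measurable (\big[setU/set0]_(ab <- index_enum ('I_p * 'I_p)%type) E1 ab).
  exact: bigsetU_measurable.
have mB2 : measurable (\big[setU/set0]_(a <- index_enum 'I_p) E2 a).
  exact: bigsetU_measurable.
apply: (@le_trans _ _ (iid P n Bad)).
  apply: le_measure; rewrite ?inE; [exact: measurable_sp_failure|exact: measurableU|].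
  move=> x fail; apply: contrapT => good.
  have small1 a b : `|average (fun v => Y a v * Y b v - (a == b)%:R) x| <= e.
    rewrite leNgt; apply/negP => /ltW big; apply: good; left.
    by rewrite -bigcup_seq; exists (a, b); rewrite //= mem_index_enum.
  have small2 a : `|average (Y a) x| <= e.
    rewrite leNgt; apply/negP => /ltW big; apply: good; right.
    by rewrite -bigcup_seq; exists a; rewrite //= mem_index_enum.
  pose W : 'M[R]_p := \matrix_(a, b) sample_cov (Y a) (Y b) x.
  have Ws : W^T = W by apply/matrixP => a b; rewrite !mxE sample_covC.
  have Wc a b : `|W a b - (a == b)%:R| <= 2 * e.
    by rewrite mxE; apply: sample_cov_close => //; exact: ltW.
  have scE : sample_cov_mx x = scaled s A *m W *m (scaled s A)^T.
    apply/matrixP => j k; rewrite mxE.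
    have uE i : Defs.coord i = fun v => center m mu A i + \sum_a scaled s A i a * Y a v.
      by apply/funext => y; rewrite /Defs.coord [LHS](unwhiten m s0 mu uA).
    rewrite [in LHS](uE j) [in LHS](uE k) sample_cov_affine// [RHS]mxE.
    apply: eq_bigr => b _; rewrite [(scaled s A *m W) _ _]mxE mulr_suml.
    by apply: eq_bigr => a _; rewrite [W a b]mxE [_^T _ _]mxE.
  have We (u w : 'rV[R]_p) : `|bilform W u w - bilform 1%:M u w| <=
      lambda / (2 * (1 + lambda)) * (norm2 u * norm2 w).
    have := bilform_close u w Wc; have -> // : 2 * e * (p ^ 2)%:R = lambda / (2 * (1 + lambda)).
    by rewrite mulrAC mulrC /e divfK// gt_eqF// mulr_gt0.
  have close_accepts j k S : (partial_cov P j k S = 0 -> accepts lambda (sample_cov_mx x) j k S) /\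
      (accepts lambda (sample_cov_mx x) j k S -> `|partial_corr P j k S| <= lambda).
    rewrite scE; apply: accepts_correct => //; first exact: scaled_unit.
    exact: (cov_law s0 h1 h2 uA PE).
  apply: (no_sp_failure dG smr _ _ fail).
  - move=> j k S ci dsepG; have ci' := mk _ _ _ ci dsepG.
    rewrite /inferred ffunE /=; have [acc _] := close_accepts j k S.
    exact: (acc (cond_indep_partial_cov0 s0 h1 h2 uA PE ci')).
  - move=> j k S ci; rewrite /inferred ffunE /=.
    by have [_ rej] := close_accepts j k S.
rewrite /Bad; apply: (le_trans (measureU2 (iid P n) mB1 mB2)).
apply: (@le_trans _ _ (\sum_ab iid P n (E1 ab) + \sum_a iid P n (E2 a))%E).
  by apply: leeD; exact: measure_bigsetU_le.
apply: (@le_trans _ _ (\sum_ab (v ab / (n%:R * e ^+ 2))%:E + \sum_(a < p) (1 / (n%:R * e ^+ 2))%:E)%E).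
  apply: leeD; apply: lee_sum => i _; apply: weak_law => //.
  - have := has_meanB (whiten_product s0 h1 h2 uA PE i.1 i.2)
      (has_mean_cst P (i.1 == i.2)%:R).
    by rewrite subrr.
  - exact: (whiten_product_sqr s0 uA PE (projT2 (vE i))).
  - exact: (whiten_mean s0 h1 uA PE).
  - have := whiten_product s0 h1 h2 uA PE i i; rewrite eqxx.
    by under [X in has_mean _ X _ -> _]eq_fun do rewrite -expr2.
rewrite !sumEFin -EFinD lee_fin -!mulr_suml -mulrDl.
by rewrite [n%:R * _]mulrC invfM mulrA lexx.
Qed.

End Consistency.

Theorem theorem3p3 (R : realType) (p : nat) (lambda : R)
    (p_gt0 : (0 < p)%N) (lambda_gt0 : 0 < lambda) :
  exists test : forall n : nat, ci_tests R p n,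
    (forall n : nat, valid_ci_tests (test n)) /\
    (fun n : nat =>
       sup [set fine (iid GP.2 n (sp_failure (test n) GP.1))
           | GP in SMR_class p lambda]) @ \oo --> (0 : R).
Proof.
exists (graph_test lambda); split; first exact: graph_test_valid.
have [K K0 bound] := uniform_failure_bound p_gt0 lambda_gt0.
(* the bound K / n says nothing for n = 0 *)
rewrite -(cvg_shiftS (fun n : nat => sup _)).
have hK : (fun n => K * harmonic n) @ \oo --> (0 : R).
  by rewrite -[X in _ --> X](mulr0 K); apply: cvgMr; exact: cvg_harmonic.
apply: (squeeze_cvgr _ (cvg_cst (0 : R)) hK).
apply: nearW => n /=; set E := [set _ | _ in _].
have E_ge0 r : E r -> 0 <= r by move=> [GP _ <-]; rewrite fine_ge0.
have E_le r : E r -> r <= K * harmonic n.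
  move=> [GP /(bound n.+1 GP isT) le_K <-]; rewrite -lee_fin fineK//.
  by rewrite ge0_fin_numE//; apply: le_lt_trans le_K _; rewrite ltry.
(* suprema are those of nonempty bounded sets, so an empty class is treated apart *)
have [->|/set0P[r Er]] := eqVneq E set0.
  by rewrite sup0 lexx mulr_ge0// invr_ge0.
apply/andP; split; last by apply: ge_sup => [|r' /E_le//]; exists r.
apply: (le_trans (E_ge0 r Er)); apply: ub_le_sup => //.
by exists (K * harmonic n) => r' /E_le.
Qed.
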